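(* Let $\mu\in\mathcal F$ and assume that $J\in C^2\left(0,\frac12\right)$. Assume furthermore that $M(p):=\inf_{t\in[p/2,1/2)}J''(t)>0$ for all $p\in(0,1/2]$. Fix $p\in[0,1/2]$ and $\lambda\in[0,2p]$. Then there exist $c=c(p)>0$ and $c'>0$ such that the following holds: (i) for any Borel set $E$ of measure $\mu(E)=p$ and asymmetry $\lambda(E)=\lambda$, $$\delta(E)\ \ge\ c\,\big[(1-\lambda)^2+(1-2p)\big]\,\lambda^2 ;$$ (ii) if in addition $J$ satisfies the $\nabla_2$-condition with $\varepsilon\in(0,1)$, $J'$ is concave on $(0,1/2)$ and $J'(0^+)=0$, then for any Borel set $E$ with $0\notin E$, of measure $\mu(E)=p$ and asymmetry $\lambda(E)=\lambda$, $$\delta(E)\ \ge\ c'\lambda^2 .$$ Moreover, one can choose $c'=\varepsilon J''(1/2^-)/32$ and $$c=\frac1{32}\min\left(8J'\left(\tfrac p2\right),\ M(p),\ 16J'\left(\tfrac16\right),\ 8\left[J\left(\tfrac12\right)-2J\left(\tfrac14\right)\right],\ 4M\left(\frac{J(1/2)-2J(1/4)}{J'(1/2^-)}\right)\right).$$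
   Context: $\mathcal F$ is the class of probability measures $\mu$ on $\mathbb R$ with no atoms and with density $f$ (with respect to Lebesgue measure), symmetric with respect to the origin, which are strictly log-convex, i.e. $\log f$ is strictly convex on $(-\infty,0)$ and on $(0,+\infty)$, and whose distribution function $F(x)=\mu((-\infty,x])$ satisfies $\inf\{x\in\mathbb R:F(x)>0\}=-\infty$ and $\sup\{x\in\mathbb R:F(x)<1\}=+\infty$. $F^{-1}$ is the inverse of $F$, with $F^{-1}(0)=-\infty$, $F^{-1}(1)=+\infty$. $J(t)=f(F^{-1}(t))$ for $0<t<1$, and $J(0)=J(1)=0$. $J'(0^+)$, $J'(1/2^-)$, $J''(1/2^-)$ denote one-sided limits. The $\mu$-perimeter of a Borel set $E$ is $P(E)=\sum_{x\in\partial^M E}f(x)$, where $\partial^M E$ is the essential boundary of $E$ (the points at which $E$ has neither Lebesgue density $0$ nor $1$). For $p\in[0,1]$: $\beta_p=-F^{-1}(p/2)$ and $\alpha_p=\beta_{1-p}$. The deficit of a set $E$ with $\mu(E)=p\le 1/2$ is $\delta(E)=P(E)-P\big((-\infty,-\beta_p)\cup(\beta_p,+\infty)\big)$. The asymmetry of $E$ with $\mu(E)=p$ is $\lambda(E)=\mu\big(E\bigtriangleup((-\infty,-\beta_p)\cup(\beta_p,+\infty))\big)$ if $p<1/2$, and for $p=1/2$ it is the minimum of $\mu\big(E\bigtriangleup((-\infty,-\beta_p)\cup(\beta_p,+\infty))\big)$ and $\mu\big(E\bigtriangleup(-\alpha_p,\alpha_p)\big)$, where $\bigtriangleup$ is the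 symmetric difference. $J$ satisfies the $\nabla_2$-condition with $\varepsilon>0$ if $J(x)\ge(2+\varepsilon)J(x/2)$ for all $x\in(0,1/2)$.
   Formalization: ''0 ∉ E'' is read as ''0 is not a point of Lebesgue density 1 of E''; f(0) is the limit of f at 0 (possibly +∞); the explicit c is asserted only if J(1/2) is finite, and its positivity only for p>0 and when J'(1/2^-) is finite or inf of J'' on (0,1/2) is positive. *)

(* Defs.v *)
From mathcomp Require Import all_boot all_order all_algebra.
From mathcomp Require Import all_classical all_reals all_analysis.
From mathcomp Require Import measurable_realfun.

Set Implicit Arguments.
Unset Strict Implicit.
Unset Printing Implicit Defensive.

Import Order.TTheory GRing.Theory Num.Theory.
Import numFieldNormedType.Exports.

Local Open Scope classical_set_scope.
Local Open Scope ring_scope.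

Section LogConvexMeasures.
Context {R : realType}.

Definition strictly_convex_on (D : set R) (g : R -> R) : Prop :=
  forall x y t : R, D x -> D y -> x != y -> 0 < t < 1 ->
    g ((1 - t) * x + t * y) < (1 - t) * g x + t * g y.

Definition concave_on (D : set R) (g : R -> R) : Prop :=
  forall x y t : R, D x -> D y -> 0 <= t <= 1 ->
    (1 - t) * g x + t * g y <= g ((1 - t) * x + t * y).

Definition distr (mu : probability (measurableTypeR R) R) (x : R) : R :=
  fine (mu `]-oo, x]%classic).

(* The perimeter and [J(1/2)] depend on the pointwise values of the density, so
   a representative has to be fixed.  Log-convexity makes [f] continuous away
   from 0; the value at 0 is the limit there, which is +oo for unbounded
   densities such as those behaving like |x|^(-1/2), hence the codomain. *)
Record classF (mu : probability (measurableTypeR R) R) (f : R -> \bar R) :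
    Prop := ClassF {
  classF_noatom : forall x : R, mu [set x] = 0%E;
  classF_meas : measurable_fun [set: R] f;
  classF_ge0 : forall x : R, (0 <= f x)%E;
  classF_density : forall A : set (measurableTypeR R), measurable A ->
    mu A = (\int[lebesgue_measure]_(x in A) f x)%E;
  classF_sym : forall A : set (measurableTypeR R), measurable A ->
    mu [set - x | x in A] = mu A;
  classF_off0 : forall x : R, x != 0 -> (0 < f x < +oo)%E;
  classF_logconvexN : strictly_convex_on `]-oo, 0[%classic (fun x => ln (fine (f x)));
  classF_logconvexP : strictly_convex_on `]0, +oo[%classic (fun x => ln (fine (f x)));
  classF_at0 : f x @[x --> 0^'] --> f 0;
  classF_inf : ereal_inf [set x%:E | x in [set x | 0 < distr mu x]] = -oo%E;
  classF_sup : ereal_sup [set x%:E | x in [set x | distr mu x < 1]] = +oo%E }.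

Definition distr_inv (mu : probability (measurableTypeR R) R) (t : R) : \bar R :=
  if t == 0 then -oo%E else if t == 1 then +oo%E
  else (xget 0 [set x | distr mu x = t])%:E.

Definition Jext (mu : probability (measurableTypeR R) R) (f : R -> \bar R)
    (t : R) : \bar R :=
  if 0 < t < 1 then f (fine (distr_inv mu t)) else 0%E.

(* [Jext] is finite on [0, 1] except possibly at 1/2, where it equals [f 0]. *)
Definition J (mu : probability (measurableTypeR R) R) (f : R -> \bar R)
    (t : R) : R := fine (Jext mu f t).

Definition lebesgue_density_at (E : set R) (x : R) (d : \bar R) : Prop :=
  (lebesgue_measure (E `&` ball x r) * (lebesgue_measure (ball x r))^-1)%E
    @[r --> 0^'+] --> d.

Definition essential_boundary (E : set R) : set R :=
  [set x | ~ lebesgue_density_at E x 0%E /\ ~ lebesgue_density_at E x 1%E].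

Definition perimeter (f : R -> \bar R) (E : set R) : \bar R :=
  \esum_(x in essential_boundary E) f x.

Definition beta (mu : probability (measurableTypeR R) R) (p : R) : \bar R :=
  (- distr_inv mu (p / 2))%E.

Definition alpha (mu : probability (measurableTypeR R) R) (p : R) : \bar R :=
  beta mu (1 - p).

Definition outer (mu : probability (measurableTypeR R) R) (p : R) : set R :=
  [set x | (x%:E < - beta mu p)%E] `|` [set x | (beta mu p < x%:E)%E].

Definition inner (mu : probability (measurableTypeR R) R) (p : R) : set R :=
  [set x | (- alpha mu p < x%:E)%E /\ (x%:E < alpha mu p)%E].

Definition mass (mu : probability (measurableTypeR R) R) (E : set R) : R :=
  fine (mu E).

(* Only meant for [mass mu E <= 1/2], as is [asymmetry] below. *)
Definition deficit (mu : probability (measurableTypeR R) R) (f : R -> \bar R)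
    (E : set R) : \bar R :=
  (perimeter f E - perimeter f (outer mu (mass mu E)))%E.

Definition asymmetry (mu : probability (measurableTypeR R) R) (E : set R) : R :=
  let p := mass mu E in
  if p < 1 / 2 then fine (mu (E `+` outer mu p))
  else Num.min (fine (mu (E `+` outer mu p))) (fine (mu (E `+` inner mu p))).

Definition C2_on (D : set R) (g : R -> R) : Prop :=
  forall t, D t -> [/\ derivable g t 1, derivable (derive1 g) t 1 &
                       {for t, continuous (derive1n 2 g)}].

(* For p > 0 the condition [0 < t] is redundant; for p = 0 it removes the point
   0, at which J'' is undefined. *)
Definition Minf (mu : probability (measurableTypeR R) R) (f : R -> \bar R)
    (p : R) : R :=
  inf [set derive1n 2 (J mu f) t | t in [set t | 0 < t /\ p / 2 <= t < 1 / 2]].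

Definition nabla2 (mu : probability (measurableTypeR R) R) (f : R -> \bar R)
    (eps : R) : Prop :=
  0 < eps /\
  forall x : R, 0 < x < 1 / 2 -> (2 + eps) * J mu f (x / 2) <= J mu f x.

(* J'(1/2^-), possibly +oo: J' is increasing on (0, 1/2). *)
Definition dJ_half (mu : probability (measurableTypeR R) R) (f : R -> \bar R) :
    \bar R :=
  lim ((derive1 (J mu f) t)%:E @[t --> (1 / 2 : R)^'-]).

Definition d2J_half (mu : probability (measurableTypeR R) R) (f : R -> \bar R) :
    R :=
  lim (derive1n 2 (J mu f) t @[t --> (1 / 2 : R)^'-]).

(* Here and in [c_explicit], [f 0] (that is, J(1/2)) is meant to be finite.
   The ratio is 0 when J'(1/2^-) = +oo. *)
Definition ratio_half (mu : probability (measurableTypeR R) R)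
    (f : R -> \bar R) : R :=
  fine ((J mu f (1 / 2) - 2 * J mu f (1 / 4))%:E / dJ_half mu f)%E.

Definition c_explicit (mu : probability (measurableTypeR R) R)
    (f : R -> \bar R) (p : R) : R :=
  1 / 32 *
  Num.min (8 * derive1 (J mu f) (p / 2))
  (Num.min (Minf mu f p)
  (Num.min (16 * derive1 (J mu f) (1 / 6))
  (Num.min (8 * (J mu f (1 / 2) - 2 * J mu f (1 / 4)))
           (4 * Minf mu f (ratio_half mu f))))).

Definition c'_explicit (mu : probability (measurableTypeR R) R)
    (f : R -> \bar R) (eps : R) : R :=
  eps * d2J_half mu f / 32.

Definition bound_i (mu : probability (measurableTypeR R) R) (f : R -> \bar R)
    (p lam c : R) : Prop :=
  forall E : set (measurableTypeR R), measurable E ->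
    mu E = p%:E -> asymmetry mu E = lam ->
    ((c * ((1 - lam) ^+ 2 + (1 - 2 * p)) * lam ^+ 2)%:E <= deficit mu f E)%E.

(* "0 is not in E" is read up to Lebesgue-null sets, i.e. for the representative
   of E made of its points of density 1.  Read literally, it could always be
   achieved by removing the single point 0 from E. *)
Definition bound_ii (mu : probability (measurableTypeR R) R) (f : R -> \bar R)
    (p lam c' : R) : Prop :=
  forall E : set (measurableTypeR R), measurable E ->
    ~ lebesgue_density_at E 0 1%E ->
    mu E = p%:E -> asymmetry mu E = lam ->
    ((c' * lam ^+ 2)%:E <= deficit mu f E)%E.

Definition hyp_ii (mu : probability (measurableTypeR R) R) (f : R -> \bar R)
    (eps : R) : Prop :=
  [/\ eps < 1, nabla2 mu f eps, concave_on `]0, 1 / 2[%classic (derive1 (J mu f)) &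
      derive1 (J mu f) t @[t --> 0^'+] --> (0 : R)].

End LogConvexMeasures.

(* Main.v *)
(* Put a = p / 2, and let psi be the tangent line of J at a, to the right of a
   increased by (inf J'' / 2) (t - a)^2.  By convexity J >= psi on (0, 1/2), and
   since f increases on the negative half-line and is even, f(x) >= psi(F(x)) for
   x <= 0, f(x) >= psi(1 - F(x)) for x >= 0, and 0 >= psi(0).

   As f is bounded below on compact sets, a set of finite perimeter has an
   isolated essential boundary, so it is null or conull on each side of every
   point.  If the origin is not a density point of E, the ends of E nearest to the
   origin on each side are distinct boundary points; they cut off tails of masses
   q1, q2 containing E, whence P(E) >= psi(q1) + psi(q2), q1 + q2 >= p, and the
   asymmetry is at most 2 ((q1 - a)_+ + (q2 - a)_+).  This bounds the deficit from
   below by J'(a) lambda / 2 or by inf J'' lambda^2 / 8.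

   If the origin is a density point of E, the same holds for the complement,
   which has the same boundary, with q1 + q2 >= 1 - p; the slope term is then at
   least J'(a) (1 - 2p), and 1 - lambda <= 2 ((q1 - a)_+ + (q2 - a)_+). *)
Require Import Defs.
From HB Require Import structures.
From mathcomp Require Import all_boot all_order all_algebra.
From mathcomp Require Import all_classical all_reals all_analysis.
From mathcomp Require Import measurable_realfun lra.
Set Implicit Arguments.
Unset Strict Implicit.
Unset Printing Implicit Defensive.
Import Order.TTheory GRing.Theory Num.Theory.
Import numFieldNormedType.Exports.
Local Open Scope classical_set_scope.
Local Open Scope ring_scope.

(** * Quadratic minorants of convex functions *)

(** The comparison is with psi instead of J because f may be infinite at the origin, so that J
    carries no information at 1/2; psi is continuous, and the comparison survives at an end placed
    there. The excess psi(q1) + psi(q2) - 2 J(a) splits into J'(a) (q1 + q2 - 2a), never negative,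
    and two one-sided squares. If both q1 and q2 are at least a, the linear term controls the total
    excess; if one falls below a, the linear term may cancel and only the square of the other is
    left. Hence both J'(p/2) and M(p) enter the constant. Symmetry of the measure speaks of sets
    only. Evenness of f at each point is extracted from monotonicity on both sides together with
    continuity, which J supplies through f = J o F. Sets of finite perimeter are never decomposed
    into intervals: only the first end met on each side of the origin counts. *)

Lemma le_tangent_left (R : realType) (g : R -> R) (t a : R) :
  t <= a ->
  {in `[t, a], forall x, derivable g x 1 /\ derivable (derive1 g) x 1} ->
  {in `[t, a], forall x, 0 <= derive1n 2 g x} ->
  g a + derive1 g a * (t - a) <= g t.
Proof.
rewrite le_eqVlt => /predU1P[->|ta] gD g2; first by rewrite subrr mulr0 addr0.
have gc (h : R -> R) : {in `[t, a], forall x, derivable h x 1} ->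
    {within `[t, a], continuous h}.
  move=> hD; apply: derivable_within_continuous => x xta; exact: hD.
have [c cta E] : exists2 c, c \in `]t, a[ & g a - g t = derive1 g c * (a - t).
  apply: MVT => // [x xta|]; last by apply: gc => x /gD[].
  rewrite derive1E; apply/derivableP; apply: (gD _ _).1.
  by apply: subset_itv_oo_cc.
move: (cta); rewrite in_itv/= => /andP[tc ca].
have gc1 : derive1 g c <= derive1 g a.
  apply: (@ger0_derive1_le_cc _ (derive1 g) t a) => //.
  - by move=> x xta; apply: (gD _ _).2; exact: subset_itv_oo_cc.
  - by move=> x xta; apply: g2; exact: subset_itv_oo_cc.
  - by apply: gc => x /gD[].
  - by rewrite in_itv/= !ltW.
  - by rewrite in_itv/= lexx !ltW.
  - exact: ltW.
have : derive1 g c * (a - t) <= derive1 g a * (a - t) by rewrite ler_pM2r// subr_gt0.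
rewrite -E; lra.
Qed.

(** Two uses of the mean value theorem replace the two integrations of g'' >= m: the first bounds g'
    from below by an affine function, the second shows that g minus the quadratic does not
    decrease. *)
Lemma le_parabola_right (R : realType) (g : R -> R) (a t m : R) :
  a <= t ->
  {in `[a, t], forall x, derivable g x 1 /\ derivable (derive1 g) x 1} ->
  {in `[a, t], forall x, m <= derive1n 2 g x} ->
  g a + derive1 g a * (t - a) + m / 2 * (t - a) ^+ 2 <= g t.
Proof.
rewrite le_eqVlt => /predU1P[->|at_] gD g2.
  by rewrite subrr mulr0 expr0n/= mulr0 !addr0.
have gc (h : R -> R) : {in `[a, t], forall x, derivable h x 1} ->
    {within `[a, t], continuous h}.
  move=> hD; apply: derivable_within_continuous => x xta; exact: hD.
have g1 x : x \in `[a, t] -> derive1 g a + m * (x - a) <= derive1 g x.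
  rewrite in_itv/= => /andP[]; rewrite le_eqVlt => /predU1P[->|ax] xt.
    by rewrite subrr mulr0 addr0.
  have [c cax E] : exists2 c, c \in `]a, x[ &
      derive1 g x - derive1 g a = derive1n 2 g c * (x - a).
    apply: (@MVT _ (derive1 g) (derive1n 2 g) a x ax) => [y yax|].
      rewrite [derive1n 2 g y]derive1E; apply/derivableP; apply: (gD _ _).2.
      by move: yax; rewrite !in_itv/= => /andP[? ?]; apply/andP; split; lra.
    apply: derivable_within_continuous => y yax; apply: (gD _ _).2.
    by move: yax; rewrite !in_itv/= => /andP[? ?]; apply/andP; split; lra.
  have cat : c \in `[a, t].
    by move: cax; rewrite !in_itv/= => /andP[? ?]; apply/andP; split; lra.
  have : m * (x - a) <= derive1n 2 g c * (x - a).
    by rewrite ler_pM2r ?subr_gt0//; exact: g2.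
  rewrite -E; lra.
pose q x := derive1 g a * (x - a) + m / 2 * (x - a) ^+ 2.
have hD x : x \in `[a, t] ->
    is_derive x 1 (g - q) (derive1 g x - (derive1 g a + m * (x - a))).
  move=> xat; have [gx _] := gD _ xat.
  have := derivableP gx; rewrite -derive1E => gx'.
  rewrite /q; apply: is_derive_eq.
  rewrite !subr0 /GRing.scale/= !mulr1. lra.
have hder x : x \in `[a, t] -> derivable (g - q) x 1 by move=> /hD[].
have [c cat E] := @MVT _ (g - q)
  (fun x => derive1 g x - (derive1 g a + m * (x - a))) a t at_
  (fun x xat => hD x (subset_itv_oo_cc xat)) (gc (g - q) hder).
have : 0 <= (g - q) t - (g - q) a.
  rewrite E mulr_ge0//; last by rewrite subr_ge0 ltW.
  rewrite subr_ge0; apply: g1; exact: subset_itv_oo_cc.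
rewrite !fctE /q subrr expr0n/= !mulr0; lra.
Qed.

(** k and k1 stand for the value and the slope at a. The maximum switches the square off to the left
    of a, where only convexity is available. *)
Definition parabola (R : realType) (k k1 m a t : R) : R :=
  k + k1 * (t - a) + m / 2 * Num.max 0 (t - a) ^+ 2.

Lemma le_parabola (R : realType) (g : R -> R) (b a t m : R) :
  C2_on `]0, b[%classic g -> 0 < a < b -> 0 < t < b ->
  {in `]0, b[, forall x, 0 <= derive1n 2 g x} ->
  {in `[a, b[, forall x, m <= derive1n 2 g x} ->
  parabola (g a) (derive1 g a) m a t <= g t.
Proof.
move=> gC /andP[a0 ab] /andP[t0 tb] g0 gm; rewrite /parabola.
have gD x : x \in `]0, b[ -> derivable g x 1 /\ derivable (derive1 g) x 1.
  by move=> /gC[].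
have [ta|at_] := leP t a.
  have -> : Num.max 0 (t - a) = 0 by apply: max_l; lra.
  rewrite expr0n/= mulr0 addr0; apply: le_tangent_left => // x;
    rewrite in_itv/= => /andP[? ?]; [apply: gD|apply: g0];
    by rewrite in_itv/=; apply/andP; split; lra.
have -> : Num.max 0 (t - a) = t - a by apply: max_r; lra.
apply: le_parabola_right; first exact: ltW.
  move=> x; rewrite in_itv/= => /andP[? ?]; apply: gD;
    by rewrite in_itv/=; apply/andP; split; lra.
move=> x; rewrite in_itv/= => /andP[? ?]; apply: gm;
    by rewrite in_itv/=; apply/andP; split; lra.
Qed.

(** * Lebesgue density and the essential boundary *)

Section EssentialBoundary.
Context {R : realType}.
Implicit Types (E : set (measurableTypeR R)) (x y r e a b : R).
Local Notation lam := (@lebesgue_measure R).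

Lemma measurableI_itv E (i : interval R) :
  measurable E -> measurable (E `&` [set` i]).
Proof. by move=> mE; apply: measurableI => //; exact: measurable_itv. Qed.

Lemma lebesgue_setI_ball_fin_num E x r : measurable E -> 0 < r ->
  lam (E `&` ball x r) \is a fin_num.
Proof.
move=> mE r0; rewrite ge0_fin_numE//; apply: le_lt_trans (ltry (r *+ 2)).
rewrite -(lebesgue_measure_ball x (ltW r0)) ball_itv le_measure ?inE//.
exact: measurableI_itv.
Qed.

(** Real counterpart of the extended quotient in [lebesgue_density_at]; [r *+ 2] is the length of
    the ball. *)
Definition density_ratio E x r : R := fine (lam (E `&` ball x r)) / (r *+ 2).

Lemma density_ratio_ge0 E x r : 0 < r -> 0 <= density_ratio E x r.
Proof.
by move=> r0; apply: divr_ge0; rewrite ?fine_ge0 ?mulrn_wge0 ?(ltW r0).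
Qed.

Lemma density_ratioC E x r : measurable E -> 0 < r ->
  density_ratio (~` E) x r = 1 - density_ratio E x r.
Proof.
move=> mE r0; have mB : measurable (ball x r : set (measurableTypeR R)).
  by rewrite ball_itv; exact: measurable_itv.
have /= := measureDI lam mB mE.
rewrite lebesgue_measure_ball ?ltW//.
rewrite setDE setIC (setIC (ball x r)).
rewrite -(fineK (lebesgue_setI_ball_fin_num x mE r0)).
rewrite -(fineK (lebesgue_setI_ball_fin_num x (measurableC mE) r0)).
rewrite -EFinD => -[rE]; rewrite /density_ratio.
have r20 : r *+ 2 != 0 by rewrite mulrn_eq0/= gt_eqF.
by rewrite -[1](divff r20) -mulrBl [X in X - _]rE addrK.
Qed.

Lemma lebesgue_density_atE E x (d : R) : measurable E ->
  lebesgue_density_at E x d%:E <-> density_ratio E x r @[r --> 0^'+] --> d.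
Proof.
move=> mE.
have DE r : 0 < r ->
    (lam (E `&` ball x r) * (lam (ball x r))^-1)%E = (density_ratio E x r)%:E.
  move=> r0; rewrite lebesgue_measure_ball ?ltW// inver mulrn_eq0/= gt_eqF//.
  by rewrite /density_ratio EFinM fineK// lebesgue_setI_ball_fin_num.
rewrite /lebesgue_density_at; split => [/fine_cvgP[_ h]|h].
  apply: cvg_trans h; apply: near_eq_cvg; near=> r.
  by rewrite /= DE.
apply/fine_cvgP; split; first by near=> r; rewrite DE.
apply: cvg_trans h; apply: near_eq_cvg; near=> r.
by rewrite /= DE.
Unshelve. all: by end_near. Qed.

Lemma lebesgue_density1C E x : measurable E ->
  lebesgue_density_at E x 1%E <-> lebesgue_density_at (~` E) x 0%E.
Proof.
move=> mE; rewrite !lebesgue_density_atE//; last exact: measurableC.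
split=> h.
  have {}h : 1 - density_ratio E x r @[r --> 0^'+] --> (1 - 1 : R).
    by apply: cvgB => //; exact: cvg_cst.
  rewrite subrr in h; apply: cvg_trans h; apply: near_eq_cvg; near=> r.
  by rewrite /= density_ratioC.
have {}h : 1 - density_ratio (~` E) x r @[r --> 0^'+] --> (1 - 0 : R).
  by apply: cvgB => //; exact: cvg_cst.
rewrite subr0 in h; apply: cvg_trans h; apply: near_eq_cvg; near=> r.
by rewrite /= density_ratioC//; lra.
Unshelve. all: by end_near. Qed.

Lemma lebesgue_density0C E x : measurable E ->
  lebesgue_density_at E x 0%E <-> lebesgue_density_at (~` E) x 1%E.
Proof.
by move=> mE; rewrite lebesgue_density1C ?setCK//; exact: measurableC.
Qed.

Lemma essential_boundaryC E : measurable E ->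
  essential_boundary (~` E) = essential_boundary E.
Proof.
move=> mE; apply/seteqP; split => x [n0 n1]; split => d.
- exact/n1/(lebesgue_density0C _ mE).1.
- exact/n0/(lebesgue_density1C _ mE).1.
- exact/n1/(lebesgue_density1C _ mE).2.
- exact/n0/(lebesgue_density0C _ mE).2.
Qed.

Lemma lebesgue_density0P E x : measurable E ->
  lebesgue_density_at E x 0%E <->
  forall e, 0 < e -> exists2 d : R, 0 < d &
    forall r, 0 < r < d -> (lam (E `&` ball x r) <= (e * r)%:E)%E.
Proof.
move=> mE; rewrite lebesgue_density_atE//.
have le_D e r : 0 < r ->
    (lam (E `&` ball x r) <= (e * r)%:E)%E = (density_ratio E x r <= e / 2).
  move=> r0; rewrite -(fineK (lebesgue_setI_ball_fin_num _ mE r0)) lee_fin.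
  rewrite /density_ratio ler_pdivrMr ?mulrn_wgt0//; congr (_ <= _); lra.
split => [/cvgrPdist_le h e e0|h].
  have e20 : 0 < e / 2 by rewrite divr_gt0.
  have [d /= d0 hd] := h _ e20; exists d => // r /andP[r0 rd].
  rewrite le_D//; have := hd r.
  rewrite /ball/= !sub0r normrN gtr0_norm// => /(_ rd r0).
  by rewrite normrN ger0_norm// density_ratio_ge0.
apply/cvgrPdist_le => e e0.
have e20 : 0 < e *+ 2 by rewrite mulrn_wgt0.
have [d d0 hd] := h _ e20.
near=> r.
have r0 : 0 < r by near: r; exact: nbhs_right_gt.
rewrite sub0r normrN ger0_norm ?density_ratio_ge0//.
have -> : e = e *+ 2 / 2 by lra.
rewrite -le_D//; apply: hd.
by rewrite r0/=; near: r; exact: nbhs_right_lt.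
Unshelve. all: by end_near. Qed.

Lemma null_density0 E x e : measurable E -> 0 < e ->
  lam (E `&` `]x - e, x[) = 0%E -> lam (E `&` `]x, x + e[) = 0%E ->
  lebesgue_density_at E x 0%E.
Proof.
move=> mE e0 l0 r0; apply/lebesgue_density0P => // e' e'0.
exists e => // r /andP[r_gt0 re].
pose A := E `&` `]x - e, x[; pose B := E `&` `]x, x + e[.
have : (lam (E `&` ball x r) <= lam (A `|` ([set x] `|` B)))%E.
  apply: le_measure; rewrite ?inE.
  - by rewrite ball_itv; exact: measurableI_itv.
  - apply: measurableU; first exact: measurableI_itv.
    by apply: measurableU; [exact: measurable_set1|exact: measurableI_itv].
  - move=> y [Ey]; rewrite ball_itv/= in_itv/= => /andP[xy yx].
    rewrite /A /B/= !in_itv/=; case: (ltgtP (y : R) x) => h.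
    + by left; split => //; rewrite (lt_trans _ xy)// ltrD2l ltrN2.
    + by right; right; split => //; rewrite (lt_trans yx)// ltrD2l.
    + by right; left.
move=> /le_trans; apply; apply: (@le_trans _ _ 0%E); last first.
  by rewrite lee_fin mulr_ge0// ltW.
rewrite measureU0//; first by rewrite [leLHS]l0.
- exact: measurableI_itv.
- by apply: measurableU; [exact: measurable_set1|exact: measurableI_itv].
- rewrite measureU0//; [exact: lebesgue_measure_set1|exact: measurableI_itv].
Qed.

(** The family [i] stands for []x - r, x[] or []x, x + r[]. If E is conull there, it fills at least
    half of each small ball, so the bound r / 2 required by density 0 fails. *)
Lemma conull_not_density0 E x e (i : R -> interval R) :
  measurable E -> 0 < e ->
  (forall r, 0 < r -> [set` i r] `<=` ball x r) ->
  (forall r, 0 < r -> lam [set` i r] = r%:E) ->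
  (forall r, 0 < r < e -> lam ([set` i r] `\` E) = 0%E) ->
  ~ lebesgue_density_at E x 0%E.
Proof.
move=> mE e0 ib il iE /lebesgue_density0P => /(_ mE 2^-1).
rewrite invr_gt0 ltr0n => /(_ isT)[d d0 h].
pose r := Num.min d e / 2.
have m0 : 0 < Num.min d e by rewrite lt_min d0.
have r0 : 0 < r by rewrite divr_gt0.
have [rd re] : r < d /\ r < e.
  have h1 : Num.min d e <= d by rewrite ge_min lexx.
  have h2 : Num.min d e <= e by rewrite ge_min lexx orbT.
  rewrite /r; split; lra.
have := h r; rewrite r0 rd => /(_ isT).
apply/negP; rewrite -ltNge.
apply: (@lt_le_trans _ _ r%:E); first by rewrite lte_fin; lra.
rewrite -il//; have /= -> := measureDI lam (measurable_itv (i r)) mE.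
rewrite iE ?r0// add0e.
apply: le_measure; rewrite ?inE.
- by apply: measurableI => //; exact: measurable_itv.
- by rewrite ball_itv; exact: measurableI_itv.
- by move=> y [/ib h1 Ey]; split => //; exact: h1.
Qed.

Lemma conull_left_not_density0 E x e : measurable E -> 0 < e ->
  lam (`]x - e, x[ `\` E) = 0%E -> ~ lebesgue_density_at E x 0%E.
Proof.
move=> mE e0 nE; apply: (@conull_not_density0 E x e (fun r => `]x - r, x[)) => //.
- move=> r r0 y; rewrite ball_itv/= !in_itv/= => /andP[-> yx]/=.
  by rewrite (lt_trans yx)// ltrDl.
- move=> r r0; rewrite lebesgue_measure_itv/= lte_fin gtrBl r0.
  by rewrite -EFinD; congr EFin; lra.
- move=> r /andP[r0 re]; apply/eqP; rewrite eq_le measure_ge0 andbT -nE.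
  rewrite le_measure ?inE//; [exact: measurableD|exact: measurableD|].
  apply: setSD => y; rewrite /= !in_itv/= => /andP[h ->]; rewrite andbT.
  by rewrite (lt_trans _ h)// ltrD2l ltrN2.
Qed.

Lemma conull_right_not_density0 E x e : measurable E -> 0 < e ->
  lam (`]x, x + e[ `\` E) = 0%E -> ~ lebesgue_density_at E x 0%E.
Proof.
move=> mE e0 nE; apply: (@conull_not_density0 E x e (fun r => `]x, x + r[)) => //.
- move=> r r0 y; rewrite ball_itv/= !in_itv/= => /andP[yx ->]/=.
  by rewrite (lt_trans _ yx)// gtrBl.
- move=> r r0; rewrite lebesgue_measure_itv/= lte_fin ltrDl r0.
  by rewrite -EFinD; congr EFin; lra.
- move=> r /andP[r0 re]; apply/eqP; rewrite eq_le measure_ge0 andbT -nE.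
  rewrite le_measure ?inE//; [exact: measurableD|exact: measurableD|].
  apply: setSD => y; rewrite /= !in_itv/= => /andP[->]/= h.
  by rewrite (lt_trans h)// ltrD2l.
Qed.

End EssentialBoundary.

(** Differentiability without a quotient: density statements bound increments of the mass in exactly
    this form. *)
Lemma is_derive_estimate (R : realType) (h : R -> R) (x v : R) :
  (forall e, 0 < e -> exists2 d : R, 0 < d &
    forall y, y != x -> `|y - x| < d ->
      `|h y - h x - v * (y - x)| <= e * `|y - x|) ->
  is_derive x 1 h v.
Proof.
move=> hE; suff cv : k^-1 *: (h (k *: 1 + x) - h x) @[k --> 0^'] --> v.
  by apply: DeriveDef; [apply/cvg_ex; exists v|exact/cvg_lim].
apply/cvgrPdist_le => e e0; have [d d0 hd] := hE _ e0.
exists d => //= k; rewrite /ball/= sub0r normrN => kd k0.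
have := hd (k + x); rewrite addrK -subr_eq0 addrK => /(_ k0 kd).
rewrite /GRing.scale/= mulr1 distrC.
rewrite -[leRHS]mulrC -ler_pdivrMl ?normr_gt0//.
rewrite -normfV -normrM mulrBr; congr (_ <= _); congr (`|_|).
by rewrite (mulrC v) mulKf.
Qed.

(** * Sets without essential boundary in an interval *)

Section NullOrConull.
Context {R : realType}.
Variable E : set (measurableTypeR R).
Hypothesis mE : measurable E.
Implicit Types (x y r e a b : R).
Local Notation lam := (@lebesgue_measure R).

Lemma lebesgue_setI_itv_fin_num (A : set (measurableTypeR R)) a b :
  measurable A -> lam (A `&` `[a, b[) \is a fin_num.
Proof.
move=> mA; rewrite ge0_fin_numE//.
have : (lam (A `&` `[a, b[) <= lam `[a, b[)%E.
  by rewrite le_measure ?inE//; exact: measurableI_itv.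
move=> /le_lt_trans; apply; rewrite lebesgue_measure_itv/=.
by case: ifPn => // _; rewrite -EFinD ltry.
Qed.

(** Primitive of the indicator function of A, constantly 0 to the left of a. *)
Definition partial_mass (A : set (measurableTypeR R)) a x : R :=
  fine (lam (A `&` `[a, x[)).

Lemma partial_massB (A : set (measurableTypeR R)) a x y : measurable A ->
  a <= x -> x <= y ->
  ((partial_mass A a y - partial_mass A a x)%:E = lam (A `&` `[x, y[))%E.
Proof.
move=> mA ax xy; rewrite EFinB !fineK ?lebesgue_setI_itv_fin_num//.
have /= -> : lam (A `&` `[a, y[) = (lam (A `&` `[a, x[) + lam (A `&` `[x, y[))%E.
  rewrite -measureU//=.
  - rewrite -setIUr; congr (lam (_ `&` _)).
    apply/seteqP; split => z /=; rewrite !in_itv/=.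
      by move=> /andP[-> ->]; case: (ltP (z : R) x) => _; [left|right].
    move=> [/andP[-> zx]|/andP[xz ->]]; first by rewrite (lt_le_trans zx).
    by rewrite (le_trans ax).
  - exact: measurableI_itv.
  - exact: measurableI_itv.
  - rewrite setIACA setIid; apply/seteqP; split => // z [_ []] /=.
    by rewrite !in_itv/= => /andP[_ +] /andP[+ _]; case: ltP.
by rewrite addeAC subee ?add0e// lebesgue_setI_itv_fin_num.
Qed.

Lemma density0_partial_mass (A : set (measurableTypeR R)) a x e :
  measurable A -> a < x -> lebesgue_density_at A x 0%E -> 0 < e ->
  exists2 d : R, 0 < d & forall y, `|y - x| < d -> a < y /\
    `|partial_mass A a y - partial_mass A a x| <= e * `|y - x|.
Proof.
move=> mA ax /lebesgue_density0P => /(_ mA (e / 2)) dA e0.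
have [d d0 hd] := dA (divr_gt0 e0 (ltr0n _ 2)).
(* The radius is doubled so that the closed end y of [[y, x[] lies in the open ball; halving e
   compensates for it. *)
have main u v y : a < u -> u <= v -> v - u <= `|y - x| -> 0 < `|y - x| ->
    `|y - x| < d / 2 -> `[u, v[ `<=` ball x (2 * `|y - x|) ->
    0 <= partial_mass A a v - partial_mass A a u <= e * `|y - x|.
  move=> au uv vuyx yx0 yxd uvb.
  rewrite -!lee_fin partial_massB ?(ltW au)//.
  apply/andP; split; first exact: measure_ge0.
  apply: (@le_trans _ _ (lam (A `&` ball x (2 * `|y - x|)))).
    rewrite le_measure ?inE//; first exact: measurableI_itv.
      by rewrite ball_itv; exact: measurableI_itv.
    exact: setIS.
  apply: le_trans (hd _ _) _; last by rewrite lee_fin; lra.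
  by apply/andP; split; lra.
exists (Num.min (d / 2) (x - a)) => [|y].
  by rewrite lt_min divr_gt0//= subr_gt0.
rewrite lt_min => /andP[yxd yxa].
have ay : a < y by move: yxa; rewrite ltr_norml => /andP[]; lra.
split => //; have [xy|yx|->] := ltgtP x y; last 1 first.
- by rewrite !subrr normr0 mulr0.
- have E0 : `|y - x| = y - x by rewrite gtr0_norm// subr_gt0.
  have /andP[h1 h2] : 0 <= partial_mass A a y - partial_mass A a x
      <= e * `|y - x|.
    have le0 : y - x <= `|y - x| by rewrite E0.
    have gt0 : 0 < `|y - x| by rewrite E0 subr_gt0.
    apply: (main x y y ax (ltW xy) le0 gt0 yxd).
    rewrite ball_itv E0; apply: subset_itv; rewrite bnd_simp; lra.
  by rewrite ger0_norm.
- have E0 : `|y - x| = x - y by rewrite ltr0_norm ?subr_lt0// opprB.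
  have /andP[h1 h2] : 0 <= partial_mass A a x - partial_mass A a y
      <= e * `|y - x|.
    have le0 : x - y <= `|y - x| by rewrite E0.
    have gt0 : 0 < `|y - x| by rewrite E0 subr_gt0.
    apply: (main y x y ay (ltW yx) le0 gt0 yxd).
    rewrite ball_itv E0; apply: subset_itv; rewrite bnd_simp; lra.
  by rewrite distrC ger0_norm.
Qed.

Lemma partial_massC a x : a <= x ->
  partial_mass (~` E) a x = (x - a) - partial_mass E a x.
Proof.
move=> ax; have /= := measureDI lam (measurable_itv `[a, x[) mE.
rewrite lebesgue_measure_itv/= lte_fin setDE setIC (setIC [set` _]).
rewrite -(fineK (lebesgue_setI_itv_fin_num a x mE)).
rewrite -(fineK (lebesgue_setI_itv_fin_num a x (measurableC mE))).
rewrite -/(partial_mass E a x) -/(partial_mass (~` E) a x).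
case: ifPn => [_ [->]|]; first by rewrite addrK.
rewrite -leNgt => xa [h]; have xaE : x = a by apply/eqP; rewrite eq_le xa ax.
by move: h; rewrite xaE => h; lra.
Qed.

(** Off the essential boundary the density is 0 or 1. Density 1 reduces to density 0 of the
    complement, whose partial mass is x - a minus that of E. *)
Lemma is_derive_partial_mass a x : a < x -> ~ essential_boundary E x ->
  is_derive x 1 (partial_mass E a) 0 \/ is_derive x 1 (partial_mass E a) 1.
Proof.
move=> ax nx; have [d0|n0] := pselect (lebesgue_density_at E x 0%E).
  left; apply: is_derive_estimate => e e0.
  have [d dgt0 hd] := density0_partial_mass mE ax d0 e0.
  by exists d => // y _ /hd[_]; rewrite mul0r subr0.
have [d1|n1] := pselect (lebesgue_density_at E x 1%E); last by case: nx.
right; apply: is_derive_estimate => e e0.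
have [d dgt0 hd] := density0_partial_mass (measurableC mE) ax
  ((lebesgue_density1C _ mE).1 d1) e0.
exists d => // y _ /hd[ay]; rewrite !partial_massC ?(ltW ax) ?(ltW ay)//.
by rewrite -normrN; congr (_ <= _); congr (`|_|); lra.
Qed.

(** Points on both sides of a are allowed, so that continuity, which the mean value theorem needs at
    the end a too, holds on the whole line. *)
Lemma partial_mass_lipschitz a x y : x <= y ->
  0 <= partial_mass E a y - partial_mass E a x <= y - x.
Proof.
have pm0 z : z <= a -> partial_mass E a z = 0.
  move=> za; rewrite /partial_mass set_itv_ge ?setI0 ?measure0//.
  by rewrite bnd_simp -leNgt.
have pmB u v : a <= u -> u <= v ->
    0 <= partial_mass E a v - partial_mass E a u <= v - u.
  move=> au uv; rewrite -!lee_fin partial_massB//.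
  apply/andP; split; first exact: measure_ge0.
  apply: (@le_trans _ _ (lam `[u, v[)).
    by rewrite le_measure ?inE//; exact: measurableI_itv.
  rewrite lebesgue_measure_itv/= lte_fin -EFinD.
  by case: ifPn => // _; rewrite lee_fin subr_ge0.
move=> xy; have [ax|xa] := leP a x; first exact: pmB.
rewrite (pm0 x (ltW xa)) subr0; have [ay|ya] := leP a y.
  have := pmB _ _ (lexx a) ay; rewrite (pm0 a)// subr0 => /andP[h1 h2].
  by apply/andP; split; lra.
by rewrite (pm0 y (ltW ya)) lexx subr_ge0.
Qed.

Lemma continuous_partial_mass a : continuous (partial_mass E a).
Proof.
move=> x; apply/cvgrPdist_le => e e0; exists e => //= y.
rewrite /ball/= => /ltW; apply: le_trans.
have [xy|yx] := leP x y.
  have /andP[h1 h2] := partial_mass_lipschitz a xy.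
  by rewrite distrC ger0_norm// (le_trans h2)// distrC ler_norm.
have /andP[h1 h2] := partial_mass_lipschitz a (ltW yx).
by rewrite ger0_norm// (le_trans h2)// ler_norm.
Qed.

(* Where there is no essential boundary, the derivative of the partial mass only
   takes the values 0 and 1, hence so does its mean slope. *)
Lemma null_or_conull a b : a < b ->
  (forall x, a < x < b -> ~ essential_boundary E x) ->
  lam (E `&` `]a, b[) = 0%E \/ lam (`]a, b[ `\` E) = 0%E.
Proof.
move=> ab nE; pose df x := 'D_1 (partial_mass E a) x.
have dfE x : x \in `]a, b[ -> is_derive x 1 (partial_mass E a) (df x) /\
    (df x = 0 \/ df x = 1).
  rewrite in_itv/= => axb; have /andP[ax _] := axb.
  by have [d|d] := is_derive_partial_mass ax (nE _ axb); rewrite /df derive_val;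
    split=> //; [left|right].
have [c cab E1] := @MVT _ (partial_mass E a) df a b ab (fun x h => (dfE x h).1)
  (continuous_subspaceT (@continuous_partial_mass a)).
have pma (A : set (measurableTypeR R)) : partial_mass A a a = 0.
  by rewrite /partial_mass set_itvco0 setI0 measure0.
have null A : measurable A -> partial_mass A a b = 0 ->
    lam (A `&` `]a, b[) = 0%E.
  move=> mA A0; have := partial_massB mA (lexx a) (ltW ab).
  rewrite A0 pma subrr => A1; apply/eqP; rewrite eq_le measure_ge0 andbT [leRHS]A1.
  rewrite le_measure ?inE//; [exact: measurableI_itv|exact: measurableI_itv|].
  by apply: setIS => x; rewrite /= !in_itv/= => /andP[/ltW-> ->].
rewrite pma subr0 in E1; have [_ [d|d]] := dfE c cab.
  by left; apply: null => //; rewrite E1 d mul0r.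
right; rewrite setDE setIC; apply: null; first exact: measurableC.
by rewrite partial_massC ?ltW// E1 d mul1r subrr.
Qed.

End NullOrConull.

(** * Isolated essential boundary and the nearest end of a set *)

Section IntervalStructure.
Context {R : realType}.
Implicit Types (E A : set (measurableTypeR R)) (x y r e a b c : R).
Local Notation lam := (@lebesgue_measure R).

Lemma lebesgue_oppr_preimage A : measurable A ->
  lam [set x | A (- x)] = lam A.
Proof. by move=> mA; rewrite -(lebesgue_measureN mA). Qed.

Lemma measurable_oppr_preimage A : measurable A ->
  measurable ([set x | A (- x)] : set (measurableTypeR R)).
Proof.
move=> mA; rewrite -[X in measurable X]setTI.
exact: (@oppr_measurable R setT measurableT A mA).
Qed.

Definition left_null_or_conull E := forall x, exists2 e, 0 < e &
  lam (E `&` `]x - e, x[) = 0%E \/ lam (`]x - e, x[ `\` E) = 0%E.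

Definition right_null_or_conull E := forall x, exists2 e, 0 < e &
  lam (E `&` `]x, x + e[) = 0%E \/ lam (`]x, x + e[ `\` E) = 0%E.

Definition isolated_boundary E := forall x, exists2 e, 0 < e &
  forall y, y != x -> `|y - x| < e -> ~ essential_boundary E y.

Lemma isolated_left_null_or_conull E : measurable E ->
  isolated_boundary E -> left_null_or_conull E.
Proof.
move=> mE iE x; have [e e0 he] := iE x; exists e => //.
apply: null_or_conull => //; first by rewrite gtrBl.
move=> y /andP[h1 h2]; apply: he; first by rewrite lt_eqF.
by rewrite ltr0_norm ?subr_lt0//; lra.
Qed.

Lemma isolated_right_null_or_conull E : measurable E ->
  isolated_boundary E -> right_null_or_conull E.
Proof.
move=> mE iE x; have [e e0 he] := iE x; exists e => //.
apply: null_or_conull => //; first by rewrite ltrDl.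
move=> y /andP[h1 h2]; apply: he; first by rewrite gt_eqF.
by rewrite gtr0_norm ?subr_gt0//; lra.
Qed.

(** The end x is the infimum of the y for which E is null on []y, c[]. Either this set is unbounded
    below, or the local alternative at x must be the conull one. *)
Lemma left_end E c : measurable E -> left_null_or_conull E ->
  (forall y, y < c -> lam (E `&` `]y, c[) = 0%E) \/
  exists x, [/\ x <= c, lam (E `&` `]x, c[) = 0%E &
    exists2 e, 0 < e & lam (`]x - e, x[ `\` E) = 0%E].
Proof.
move=> mE lE.
have [h|/existsNP[y0 /not_implyP[y0c ny0]]] :=
  pselect (forall y, y < c -> lam (E `&` `]y, c[) = 0%E); [by left|right].
pose S := [set y : R | y <= c /\ lam (E `&` `]y, c[) = 0%E].
have Sc : S c by split => //; rewrite set_itvoo0 setI0 measure0.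
have mono y z : y <= z -> (lam (E `&` `]z, c[) <= lam (E `&` `]y, c[))%E.
  move=> yz; rewrite le_measure ?inE//; try exact: measurableI_itv.
  by apply: setIS; apply: subset_itvr; rewrite bnd_simp.
have lbS : lbound S y0.
  move=> y [_ Sy]; rewrite leNgt; apply/negP => /ltW /mono; rewrite Sy => h.
  by apply: ny0; apply/eqP; rewrite eq_le h measure_ge0.
have hS : has_inf S by split; [exists c|exists y0].
pose x := inf S; have xc : x <= c by apply: ge_inf => //; exists y0.
(* The infimum is attained: some y of S lies within e of x, and []x, y]] adds at most e to the
   measure. *)
have nx : lam (E `&` `]x, c[) = 0%E.
  apply/eqP; rewrite eq_le measure_ge0 andbT; apply/lee_addgt0Pr => e e0.
  have [y [yc Sy] yx] := inf_adherent e0 hS.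
  have xy : x <= y by apply: ge_inf => //; exists y0.
  apply: (@le_trans _ _ (lam (`]x, y] `|` (E `&` `]y, c[)))).
    rewrite le_measure ?inE//; first exact: measurableI_itv.
      by apply: measurableU => //; exact: measurableI_itv.
    move=> z [Ez]; rewrite /= !in_itv/= => /andP[-> ->].
    by case: (leP (z : R) y); [left|right].
  rewrite add0e measureU0//; last exact: measurableI_itv.
  rewrite [leLHS]lebesgue_measure_itv/= lte_fin -EFinD.
  by case: ifPn => _; rewrite lee_fin; move: yx; rewrite -/x; lra.
exists x; split => //; have [e e0 [hl|hr]] := lE x; last by exists e.
(* If E were null just to the left of x, the infimum could be moved further left. *)
suff : S (x - e) by move=> /(ge_inf (ex_intro _ _ lbS)); rewrite -/x; lra.
split; first lra.
apply/eqP; rewrite eq_le measure_ge0 andbT.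
pose A := E `&` `]x - e, x[; pose B := E `&` `]x, c[.
apply: (@le_trans _ _ (lam (A `|` ([set x] `|` B)))).
  rewrite le_measure ?inE//; first exact: measurableI_itv.
    apply: measurableU; first exact: measurableI_itv.
    by apply: measurableU; [exact: measurable_set1|exact: measurableI_itv].
  move=> z [Ez]; rewrite /A /B /= !in_itv/= => /andP[xz zc].
  case: (ltgtP (z : R) x) => h; [left|right;right|by right;left];
    by split => //; apply/andP.
rewrite measureU0//; first by rewrite [leLHS]hl.
- exact: measurableI_itv.
- by apply: measurableU; [exact: measurable_set1|exact: measurableI_itv].
- rewrite measureU0//; [exact: lebesgue_measure_set1|exact: measurableI_itv].
Qed.

Lemma lebesgue_oppr_itvI E a b : measurable E ->
  lam ([set x | E (- x)] `&` `]a, b[) = lam (E `&` `]- b, - a[).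
Proof.
move=> mE; rewrite -(lebesgue_oppr_preimage (measurableI_itv _ mE)).
by congr (lam _); apply/seteqP; split => x /=; rewrite !in_itv/= !ltrN2 andbC.
Qed.

Lemma lebesgue_oppr_itvD E a b : measurable E ->
  lam (`]a, b[ `\` [set x | E (- x)]) = lam (`]- b, - a[ `\` E).
Proof.
move=> mE.
rewrite -(lebesgue_oppr_preimage (measurableD (measurable_itv `]- b, - a[) mE)).
by congr (lam _); apply/seteqP; split => x /=; rewrite !in_itv/= !ltrN2 andbC.
Qed.

Lemma right_null_or_conull_oppr E : measurable E -> right_null_or_conull E ->
  left_null_or_conull [set x | E (- x)].
Proof.
move=> mE rE x; have [e e0 he] := rE (- x); exists e => //.
by rewrite lebesgue_oppr_itvI// lebesgue_oppr_itvD// opprB addrC.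
Qed.

(** Conullness on the left excludes density 0; nullness on the right is conullness of the complement
    and excludes density 1. *)
Lemma left_end_boundary E x c e : measurable E -> 0 < e -> x < c ->
  lam (E `&` `]x, c[) = 0%E -> lam (`]x - e, x[ `\` E) = 0%E ->
  essential_boundary E x.
Proof.
move=> mE e0 xc r l; split; first exact: conull_left_not_density0 l.
move/(lebesgue_density1C _ mE); apply: (@conull_right_not_density0 _ _ _ (c - x)).
- exact: measurableC.
- by rewrite subr_gt0.
- by rewrite setDE setCK setIC subrKC.
Qed.

Lemma right_end_boundary E x c e : measurable E -> 0 < e -> c < x ->
  lam (E `&` `]c, x[) = 0%E -> lam (`]x, x + e[ `\` E) = 0%E ->
  essential_boundary E x.
Proof.
move=> mE e0 cx l r; split; first exact: conull_right_not_density0 r.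
move/(lebesgue_density1C _ mE); apply: (@conull_left_not_density0 _ _ _ (x - c)).
- exact: measurableC.
- by rewrite subr_gt0.
- by rewrite setDE setCK setIC opprB addrC subrK.
Qed.

Lemma seq_isolated (s : seq R) x : exists2 e, 0 < e &
  forall y, y != x -> `|y - x| < e -> y \notin s.
Proof.
elim: s => [|z s [e e0 he]]; first by exists 1.
have [zx|zx] := eqVneq z x.
  exists e => // y yx yxe; rewrite inE negb_or (he _ yx yxe) andbT.
  by rewrite zx.
exists (Num.min e `|z - x|) => [|y yx]; first by rewrite lt_min e0 normr_gt0 subr_eq0.
rewrite lt_min => /andP[ye yz]; rewrite inE negb_or (he _ yx ye) andbT.
by apply: contraTneq yz => ->; rewrite ltxx.
Qed.

Lemma sum_le_perimeter (f : R -> \bar R) (E : set R) (s : seq R) : uniq s ->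
  (forall y, y \in s -> essential_boundary E y) ->
  (\sum_(y <- s) f y <= perimeter f E)%E.
Proof.
move=> us sE; apply: esum_ge; exists [set` s]; last by rewrite -fsbig_seq.
by split; [exact: finite_seq|move=> y; exact: sE].
Qed.

(** Each boundary point within distance 1 of x contributes at least some fixed d > 0 to the
    perimeter, so there are finitely many of them. *)
Lemma finite_perimeter_isolated (f : R -> \bar R) (E : set R) :
  (forall x, 0 <= f x)%E ->
  (forall r, exists2 d : R, 0 < d & forall x, `|x| <= r -> (d%:E <= f x)%E) ->
  (perimeter f E < +oo)%E -> isolated_boundary E.
Proof.
move=> f0 fd pE x.
pose B := essential_boundary E `&` [set y | `|y - x| <= 1].
have /finite_seqP[s sB] : finite_set B.
  apply: contrapT => /infinite_set_fset iB.
  have [d d0 hd] := fd (1 + `|x|).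
  have pfin : perimeter f E \is a fin_num by rewrite ge0_fin_numE// esum_ge0.
  (* More than P / d points, where P is the perimeter, already have total weight above P. *)
  have [F FB cF] := iB (Num.trunc (fine (perimeter f E) / d)).+1.
  pose s := finmap.enum_fset F.
  have sB y : y \in s -> B y by move=> ys; apply: FB.
  have : (\sum_(y <- s) d%:E <= perimeter f E)%E.
    apply: le_trans (sum_le_perimeter _ (finmap.fset_uniq F) _); last first.
      by move=> y /sB[].
    rewrite big_seq [leRHS]big_seq; apply: lee_sum => y yF; apply: hd.
    have [_ /= yx] := sB _ yF; rewrite -(subrK x y).
    by rewrite (le_trans (ler_normD _ _))// lerD2r.
  rewrite sumEFin big_const_seq iter_addr addr0 count_predT.
  rewrite -(fineK pfin) lee_fin leNgt => /negP; apply.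
  rewrite -mulr_natr mulrC -ltr_pdivrMr//.
  by rewrite (lt_le_trans (truncnS_gt _))// ler_nat.
have [e e0 he] := seq_isolated s x.
exists (Num.min e 1) => [|y yx]; first by rewrite lt_min e0 ltr01.
rewrite lt_min => /andP[ye y1] By; have /negP := he _ yx ye; apply.
by have : B y by [split => //=; exact: ltW]; rewrite sB.
Qed.

End IntervalStructure.

(** * Distribution function and log-convex density *)

Section DistributionFunction.
Context {R : realType}.

(** The identity seen as a random variable of law mu, so that [distr mu] becomes its cumulative
    distribution function. *)
Definition idR : measurableTypeR R -> R := idfun.

#[local] HB.instance Definition _ :=
  @isMeasurableFun.Build _ _ _ _ idR (@measurable_id _ _ setT).

Variable mu : probability (measurableTypeR R) R.
Hypothesis noatom : forall x, mu [set x] = 0%E.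
Hypothesis sym : forall A : set (measurableTypeR R), measurable A ->
  mu [set - x | x in A] = mu A.
Implicit Types (x y : R).
Local Notation F := (distr mu).

Lemma prob_fin_num (A : set (measurableTypeR R)) : measurable A ->
  mu A \is a fin_num.
Proof. exact: fin_num_measure. Qed.

(** The boolean selects an open or closed end; in the absence of atoms both have the same mass. *)
Lemma mu_itvNy (b : bool) x : mu [set` Interval -oo%O (BSide b x)] = (F x)%:E.
Proof.
have mc : mu [set` `]-oo, x]] = (F x)%:E by rewrite fineK// prob_fin_num.
case: b => //; rewrite -mc -[in RHS](@setUitv1 _ _ _ _ true)//.
by apply/esym/measureU0 => //; exact: noatom.
Qed.

Lemma mu_itvy (b : bool) x :
  mu [set` Interval (BSide b x) +oo%O] = (1 - F x)%:E.
Proof. by rewrite -setCitvl probability_setC// mu_itvNy. Qed.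

Lemma mu_itv (b c : bool) x y : x <= y ->
  mu [set` Interval (BSide b x) (BSide c y)] = (F y - F x)%:E.
Proof.
rewrite le_eqVlt => /predU1P[->|xy].
  rewrite subrr; apply/eqP; rewrite eq_le measure_ge0 andbT -[leRHS](noatom y).
  rewrite le_measure ?inE// => z /=; rewrite in_itv/= => /andP[h1 h2].
  apply/eqP; rewrite eq_le; apply/andP; split.
    by case: c h2 => //= /ltW.
  by case: b h1 => //= /ltW.
have /= E : mu [set` Interval -oo%O (BSide c y)] =
    (mu [set` Interval -oo%O (BSide b x)] +
     mu [set` Interval (BSide b x) (BSide c y)])%E.
  rewrite -measureU//.
    rewrite -itv_bndbnd_setU//.
    by case: b; case: c; rewrite bnd_simp// ltW.
  apply/seteqP; split => // z [] /=; rewrite !in_itv/= => h /andP[h' _].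
  by case: b h h' => /=; [case: ltP|case: leP].
move: E; rewrite !mu_itvNy.
have /fineK <- := prob_fin_num (measurable_itv (Interval (BSide b x) (BSide c y))).
by rewrite -EFinD => -[->]; rewrite addrAC subrr add0r.
Qed.

Lemma le_distr x y : x <= y -> F x <= F y.
Proof.
by move=> xy; rewrite -subr_ge0 -lee_fin -(mu_itv false false xy) measure_ge0.
Qed.

Lemma distr_ge0 x : 0 <= F x.
Proof. exact: fine_ge0. Qed.

Lemma distrN x : F (- x) = 1 - F x.
Proof.
apply: EFin_inj; rewrite -(mu_itvy true) -(mu_itvNy false) -sym//.
congr (mu _); apply/seteqP; split => y /=.
  by move=> [z] /=; rewrite !in_itv/= andbT => zx <-; rewrite lerNr.
by rewrite in_itv/= andbT => xy; exists (- y); rewrite ?opprK// in_itv/= lerN2.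
Qed.

Lemma distr0 : F 0 = 1 / 2.
Proof. by have := distrN 0; rewrite oppr0; lra. Qed.

Lemma distr_cdf : cdf (idR : {RV mu >-> R}) = fun x => (F x)%:E.
Proof. by apply/funext => x; rewrite -(mu_itvNy false). Qed.

Lemma distr_at_right x : F y @[y --> x^'+] --> F x.
Proof.
apply: (@fine_cvg _ _ _ _ (fun y => (F y)%:E)).
by have := @cdf_right_continuous _ _ _ _ (idR : {RV mu >-> R}) x; rewrite distr_cdf.
Qed.

(** Right continuity holds for every distribution function, and F(-x) = 1 - F(x) carries it over to
    the left. *)
Lemma continuous_distr : continuous F.
Proof.
move=> x; apply/left_right_continuousP; split; last exact: distr_at_right.
apply/cvg_at_leftNP; have -> : F \o -%R = fun y => 1 - F y.
  by apply/funext => y; rewrite /= distrN.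
have -> : F x = 1 - F (- x) by rewrite distrN; lra.
by apply: cvgB; [exact: cvg_cst|exact: distr_at_right].
Qed.

Lemma distr_small e : 0 < e -> exists2 x, x < 0 & F x < e.
Proof.
move=> e0; have := @cvg_cdfNy0 _ _ _ _ (idR : {RV mu >-> R}); rewrite distr_cdf.
move=> /fine_cvgP[_ /cvgrPdist_lt/(_ e e0)[A [_ hA]]].
exists (Num.min (A - 1) (-1)).
  by rewrite gt_min; apply/orP; right; lra.
have := hA (Num.min (A - 1) (-1)); rewrite /= sub0r normrN ger0_norm ?distr_ge0//; apply.
by rewrite gt_min; apply/orP; left; lra.
Qed.

Lemma distr_surj (a : R) : 0 < a < 1 / 2 -> exists2 x, x < 0 & F x = a.
Proof.
move=> /andP[a0 a2]; have [x x0 Fx] := distr_small a0.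
have [||y] := @IVT _ F x 0 a (ltW x0).
- exact/continuous_subspaceT/continuous_distr.
- by rewrite distr0 ge_min le_max (ltW Fx) (ltW a2) orbT.
rewrite in_itv/= => /andP[_]; rewrite le_eqVlt => /predU1P[->|y0 Fy].
  by rewrite distr0 => E; move: a2; rewrite E ltxx.
by exists y.
Qed.

End DistributionFunction.

(** * Monotonicity, evenness and lower bounds of the density *)

Section LogConvexDensity.
Context {R : realType}.
Variables (mu : probability (measurableTypeR R) R) (f : R -> \bar R).
Hypothesis muF : classF mu f.
Implicit Types (x y z c e : R) (A : set (measurableTypeR R)).
Local Notation lam := (@lebesgue_measure R).
Local Notation F := (distr mu).
Local Notation fr := (fun x => fine (f x)).

Let mu_density A (mA : measurable A) := classF_density muF mA.
Let noatom := classF_noatom muF.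
Let sym := classF_sym muF.

Lemma null_mu A : measurable A -> lam A = 0%E -> mu A = 0%E.
Proof.
move=> mA A0; rewrite mu_density// null_set_integral//.
exact: measurable_funS (classF_meas muF).
Qed.

Lemma mass_ge A c : measurable A -> 0 <= c ->
  (forall x, A x -> (c%:E <= f x)%E) -> (c%:E * lam A <= mu A)%E.
Proof.
move=> mA c0 cf; rewrite mu_density// -integral_cst//.
apply: ge0_le_integral => //=.
exact: measurable_funS (classF_meas muF).
Qed.

Lemma mass_le A c : measurable A -> 0 <= c ->
  (forall x, A x -> (f x <= c%:E)%E) -> (mu A <= c%:E * lam A)%E.
Proof.
move=> mA c0 cf; rewrite mu_density// -integral_cst//.
apply: ge0_le_integral => //=.
- by move=> x _; exact: classF_ge0 muF _.
- exact: measurable_funS (classF_meas muF).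
Qed.

Lemma fineK_density x : x != 0 -> (fr x)%:E = f x.
Proof.
move=> /(classF_off0 muF)/andP[f0 fy]; rewrite fineK//.
by rewrite ge0_fin_numE// ltW.
Qed.

Lemma density_gt0 x : x != 0 -> 0 < fr x.
Proof.
by move=> x0; rewrite -lte_fin fineK_density//; have /andP[] := classF_off0 muF x0.
Qed.

Lemma mass_itv_ge x y c : x <= y -> 0 <= c ->
  (forall z, x < z < y -> (c%:E <= f z)%E) -> c * (y - x) <= F y - F x.
Proof.
move=> xy c0 cf; rewrite -lee_fin -(mu_itv noatom false true xy).
have := @mass_ge [set` `]x, y[] c (measurable_itv _) c0.
rewrite lebesgue_measure_itv/= lte_fin -EFinD.
case: ifPn => [_|]; first by rewrite EFinM; apply=> z; rewrite /= in_itv/=; exact: cf.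
rewrite -leNgt => yx _; have -> : y = x by apply/eqP; rewrite eq_le yx xy.
by rewrite subrr mulr0 measure_ge0.
Qed.

Lemma mass_itv_le x y c : x <= y -> 0 <= c ->
  (forall z, x < z < y -> (f z <= c%:E)%E) -> F y - F x <= c * (y - x).
Proof.
move=> xy c0 cf; rewrite -lee_fin -(mu_itv noatom false true xy).
have := @mass_le [set` `]x, y[] c (measurable_itv _) c0.
rewrite lebesgue_measure_itv/= lte_fin -EFinD.
case: ifPn => [_|]; first by rewrite EFinM; apply=> z; rewrite /= in_itv/=; exact: cf.
rewrite -leNgt => yx _; have -> : y = x by apply/eqP; rewrite eq_le yx xy.
by rewrite subrr mulr0 set_itvoo0 measure0.
Qed.

Lemma distr_le1 x : F x <= 1.
Proof. by have := distr_ge0 mu (- x); rewrite distrN//; lra. Qed.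

(* Past a point where it fails to be monotone, a strictly convex function keeps
   growing. *)
Lemma strictly_convex_growth (D : set R) (g : R -> R) x y z :
  strictly_convex_on D g -> D y -> D z -> x != y ->
  (z < x < y \/ y < x < z) -> g y <= g x -> g x < g z.
Proof.
move=> cg Dy Dz xy xyz gyx; pose t := (x - z) / (y - z).
have yz : y - z != 0 by rewrite subr_eq0; apply/eqP => yz; lra.
have t01 : 0 < t < 1.
  rewrite /t; case: xyz => /andP[h1 h2].
    have yz0 : 0 < y - z by lra.
    by rewrite divr_gt0// ?subr_gt0//= ltr_pdivrMr//; lra.
  have yz0 : y - z < 0 by lra.
  rewrite -mulrNN -invrN divr_gt0//=; [|lra..].
  by rewrite ltr_pdivrMr; lra.
have zy : z != y by rewrite eq_sym -subr_eq0.
have := cg _ _ _ Dz Dy zy t01.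
have -> : (1 - t) * z + t * y = x.
  have E : t * (y - z) = x - z by rewrite /t divfK.
  lra.
move=> h; have : t * g y <= t * g x by rewrite ler_pM2l//; have /andP[] := t01.
move=> h'; have : (1 - t) * g x < (1 - t) * g z by lra.
by rewrite ltr_pM2l//; have /andP[] := t01; lra.
Qed.

(** If f(y) <= f(x), convexity of log f keeps f above f(x) on the whole half-line left of x, which
    contradicts finite mass. *)
Lemma density_ltN x y : x < y -> y < 0 -> fr x < fr y.
Proof.
move=> xy y0; rewrite ltNge; apply/negP => fyx.
have x0 : x < 0 by exact: lt_trans y0.
have pos z : z < 0 -> fr z \is Num.pos.
  by move=> z0; rewrite posrE density_gt0// lt_eqF.
have grow z : z < x -> fr x < fr z.
  move=> zx; rewrite -ltr_ln ?pos//; last exact: lt_trans x0.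
  apply: (strictly_convex_growth (y := y) (classF_logconvexN muF)).
  - by rewrite /= in_itv.
  - by rewrite /= in_itv/=; exact: lt_trans x0.
  - by rewrite lt_eqF.
  - by left; rewrite zx.
  - by rewrite ler_ln ?pos.
have fx0 : 0 < fr x by rewrite density_gt0// lt_eqF.
(* An interval of length 2 / f(x) on which f >= f(x) would have mass at least 2. *)
have zx : x - 2 / fr x <= x by rewrite gerBl divr_ge0// ltW.
have {}grow z : x - 2 / fr x < z < x -> ((fr x)%:E <= f z)%E.
  move=> /andP[_ zx']; rewrite -[f z]fineK_density ?lee_fin.
    exact/ltW/grow.
  by rewrite lt_eqF// (lt_trans zx').
have := mass_itv_ge zx (ltW fx0) grow.
have -> : fr x * (x - (x - 2 / fr x)) = 2.
  by rewrite opprB addrC subrK mulrC divfK// gt_eqF.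
have := distr_le1 x; have := distr_ge0 mu (x - 2 / fr x).
lra.
Qed.

(** This is proved separately from the left half-line because evenness of f is itself deduced below
    from monotonicity on both sides. *)
Lemma density_ltP x y : 0 < x -> x < y -> fr y < fr x.
Proof.
move=> x0 xy; rewrite ltNge; apply/negP => fyx.
have y0 : 0 < y by exact: lt_trans xy.
have pos z : 0 < z -> fr z \is Num.pos.
  by move=> z0; rewrite posrE density_gt0// gt_eqF.
have grow z : y < z -> fr y < fr z.
  move=> zx; rewrite -ltr_ln ?pos//; last exact: lt_trans zx.
  apply: (strictly_convex_growth (y := x) (classF_logconvexP muF)).
  - by rewrite /= in_itv/= x0.
  - by rewrite /= in_itv/= andbT; exact: lt_trans zx.
  - by rewrite gt_eqF.
  - by right; rewrite xy.
  - by rewrite ler_ln ?pos.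
have fy0 : 0 < fr y by rewrite density_gt0// gt_eqF.
have yz : y <= y + 2 / fr y by rewrite lerDl divr_ge0// ltW.
have {}grow z : y < z < y + 2 / fr y -> ((fr y)%:E <= f z)%E.
  move=> /andP[yz' _]; rewrite -[f z]fineK_density ?lee_fin.
    exact/ltW/grow.
  by rewrite gt_eqF// (lt_trans y0).
have := mass_itv_ge yz (ltW fy0) grow.
have -> : fr y * (y + 2 / fr y - y) = 2.
  by rewrite addrAC subrr add0r mulrC divfK// gt_eqF.
have := distr_ge0 mu y; have := distr_le1 (y + 2 / fr y).
lra.
Qed.

Lemma lt_distr x y : x < y -> F x < F y.
Proof.
move=> xy; have [x0|x0] := ltP x 0.
  (* The bound x / 2 keeps the interval strictly to the left of the origin, where f increases. *)
  pose z := Num.min y (x / 2).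
  have xz : x < z by rewrite lt_min xy/=; lra.
  have zy : z <= y by rewrite ge_min lexx.
  have zx2 : z <= x / 2 by rewrite ge_min lexx orbT.
  apply: (@lt_le_trans _ _ (F z)); last exact: le_distr.
  rewrite -subr_gt0; apply: (@lt_le_trans _ _ (fr x * (z - x))).
    by rewrite mulr_gt0// ?subr_gt0// density_gt0// lt_eqF.
  apply: mass_itv_ge => [||u /andP[xu uz]]; first exact: ltW.
    by rewrite ltW// density_gt0// lt_eqF.
  have u0 : u < 0 by lra.
  by rewrite -[f u]fineK_density ?lt_eqF// lee_fin ltW// density_ltN.
have y0 : 0 < y by exact: le_lt_trans xy.
rewrite -subr_gt0; apply: (@lt_le_trans _ _ (fr y * (y - x))).
  by rewrite mulr_gt0// ?subr_gt0// density_gt0// gt_eqF.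
apply: mass_itv_ge => [||u /andP[xu uy]]; first exact: ltW.
  by rewrite ltW// density_gt0// gt_eqF.
have u0 : 0 < u by exact: le_lt_trans xu.
by rewrite -[f u]fineK_density ?gt_eqF// lee_fin ltW// density_ltP.
Qed.

Lemma distr_gt0 x : 0 < F x.
Proof. by apply: le_lt_trans (distr_ge0 mu (x - 1)) _; rewrite lt_distr//; lra. Qed.

Lemma distr_lt1 x : F x < 1.
Proof. by have := distr_gt0 (- x); rewrite distrN//; lra. Qed.

Lemma distr_inj x y : F x = F y -> x = y.
Proof.
by move=> E; case: (ltgtP x y) => // /lt_distr; rewrite E ltxx.
Qed.

Lemma distr_lt_half x : x < 0 -> F x < 1 / 2.
Proof. by move=> /lt_distr; rewrite distr0. Qed.

Lemma distr_invK x : distr_inv mu (F x) = x%:E.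
Proof.
rewrite /distr_inv gt_eqF ?distr_gt0// lt_eqF ?distr_lt1//; congr EFin.
by case: xgetP => [y _ /distr_inj|/(_ x)/(_ erefl)].
Qed.

Lemma J_distr x : J mu f (F x) = fr x.
Proof. by rewrite /J /Jext distr_gt0 distr_lt1 distr_invK. Qed.

Hypothesis JC2 : C2_on `]0, 1 / 2[%classic (J mu f).

(** Since f = J o F, continuity of f comes from differentiability of J, which is known only below
    1/2, that is on the left half-line. *)
Lemma continuous_density x : x < 0 -> {for x, continuous fr}.
Proof.
move=> x0; have -> : fr = J mu f \o F.
  by apply/funext => y; rewrite /= J_distr.
apply: continuous_comp; first exact: continuous_distr.
have [|Jd _ _] := JC2 (t := F x).
  by rewrite /= in_itv/= distr_gt0 distr_lt_half.
exact/differentiable_continuous/derivable1_diffP.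
Qed.

Let distr_reflect x y : F (- x) - F (- y) = F y - F x.
Proof. by rewrite !distrN//; lra. Qed.

(** Reflected intervals have equal mass. Monotonicity turns this into an inequality between f(x) and
    f(y) for y near -x on either side, and continuity at -x lets y tend to -x. *)
Lemma density_even_gt0 x : 0 < x -> fr (- x) = fr x.
Proof.
move=> x0; have Nx0 : - x < 0 by rewrite oppr_lt0.
apply/eqP; rewrite eq_le; apply/andP; split.
  apply: (cvgr_to_le (cvg_at_left_filter (continuous_density Nx0))).
  near=> y.
  have yx : y < - x by near: y; exact: nbhs_left_lt.
  have xy : x < - y by rewrite ltrNr.
  have y0 : y < 0 by exact: lt_trans Nx0.
  (* f(y) times the length is at most the mass of []y, - x[], which is the mass of []x, - y[], hence
     at most f(x) times the same length. *)
  have h1 : fr y * (- x - y) <= F (- x) - F y.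
    apply: mass_itv_ge => [||z /andP[yz zx]]; first exact: ltW.
      by rewrite ltW// density_gt0// lt_eqF.
    have z0 : z < 0 by exact: lt_trans Nx0.
    by rewrite -[f z]fineK_density ?lt_eqF// lee_fin ltW// density_ltN.
  have h2 : F (- y) - F x <= fr x * (- y - x).
    apply: mass_itv_le => [||z /andP[xz _]]; first exact: ltW.
      by rewrite ltW// density_gt0// gt_eqF.
    have z0 : 0 < z by exact: lt_trans xz.
    by rewrite -[f z]fineK_density ?gt_eqF// lee_fin ltW// density_ltP.
  have := distr_reflect x (- y); rewrite opprK => E.
  have : fr y * (- x - y) <= fr x * (- x - y) by rewrite /=; lra.
  by rewrite ler_pM2r// subr_gt0.
apply: (cvgr_to_ge (cvg_at_right_filter (continuous_density Nx0))).
near=> y.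
have xy : - x < y by near: y; exact: nbhs_right_gt.
have y0 : y < 0 by near: y; exact: nbhs_right_lt.
have yx : - y < x by rewrite ltrNl.
have h1 : F y - F (- x) <= fr y * (y - - x).
  apply: mass_itv_le => [||z /andP[_ zy]]; first exact: ltW.
    by rewrite ltW// density_gt0// lt_eqF.
  have z0 : z < 0 by exact: lt_trans y0.
  by rewrite -[f z]fineK_density ?lt_eqF// lee_fin ltW// density_ltN.
have h2 : fr x * (x - - y) <= F x - F (- y).
  apply: mass_itv_ge => [||z /andP[yz zx]]; first exact: ltW.
    by rewrite ltW// density_gt0// gt_eqF.
  have z0 : 0 < z by rewrite (lt_trans _ yz)// oppr_gt0.
  by rewrite -[f z]fineK_density ?gt_eqF// lee_fin ltW// density_ltP.
have := distr_reflect (- y) x; rewrite opprK => E.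
have : fr x * (x - - y) <= fr y * (x - - y) by rewrite /=; lra.
by rewrite ler_pM2r// subr_gt0.
Unshelve. all: by end_near. Qed.

Lemma density_even x : f (- x) = f x.
Proof.
have [->|x0] := eqVneq x 0; first by rewrite oppr0.
rewrite -[LHS]fineK_density ?oppr_eq0// -[RHS]fineK_density//; congr EFin.
have [x0'|x0'] := ltP 0 x; first exact: density_even_gt0.
have Nx0 : 0 < - x by rewrite oppr_gt0 lt_neqAle x0.
by have := density_even_gt0 Nx0; rewrite opprK.
Qed.

Lemma density_le0 x : (f x <= f 0%R)%E.
Proof.
wlog x0 : x / x < 0.
  move=> h; have [x0|x0|->//] := ltgtP x 0; first exact: h.
  by rewrite -density_even h// oppr_lt0.
apply: (cvge_to_ge (cvg_dnbhs_at_left (classF_at0 muF))).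
near=> y.
have xy : x < y by near: y; exact: nbhs_left_gt.
have y0 : y < 0 by near: y; exact: nbhs_left_lt.
by rewrite -[leLHS]fineK_density ?lt_eqF// -[leRHS]fineK_density ?lt_eqF//
  lee_fin ltW// density_ltN.
Unshelve. all: by end_near. Qed.

Lemma density_lower_bound r : exists2 d : R, 0 < d &
  forall x, `|x| <= r -> (d%:E <= f x)%E.
Proof.
(* The added 1 keeps b away from 0 and strictly to the left of every -|x| with |x| <= r. *)
pose b := - (`|r| + 1); have b0 : b < 0 by rewrite oppr_lt0 ltr_wpDl.
exists (fr b); first by rewrite density_gt0// lt_eqF.
move=> x xr; rewrite fineK_density ?lt_eqF//.
have {}xr : b < - `|x|.
  by rewrite ltrN2 (le_lt_trans xr)// (le_lt_trans (ler_norm _))// ltrDl.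
have [->|x0] := eqVneq x 0; first exact: density_le0.
have -> : f x = f (- `|x|).
  have [x0'|x0'] := ltP x 0; first by rewrite ltr0_norm// opprK.
  by rewrite ger0_norm// density_even.
have Nx0 : - `|x| < 0 by rewrite oppr_lt0 normr_gt0.
by rewrite -[leLHS]fineK_density ?lt_eqF// -[leRHS]fineK_density ?(lt_eqF Nx0)//
  lee_fin ltW// density_ltN.
Qed.

(** Otherwise f >= e on the negative half-line, and an interval of length 2 / e there would have
    mass at least 2. *)
Lemma density_small e : 0 < e -> exists2 x, x < 0 & fr x < e.
Proof.
move=> e0; apply: contrapT => /forall2NP h.
have y1 : - 1 - 2 / e <= - 1 :> R by rewrite gerBl divr_ge0// ltW.
have := @mass_itv_ge _ _ e y1 (ltW e0).
have -> : e * (- 1 - (- 1 - 2 / e)) = 2.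
  by rewrite opprB addrC subrK mulrC divfK// gt_eqF.
have := distr_le1 (- 1); have := distr_ge0 mu (- 1 - 2 / e).
move=> h1 h2 H; suff : 2 <= F (- 1) - F (- 1 - 2 / e) by lra.
apply: H => z /andP[_ z1]; have z0 : z < 0 by lra.
by rewrite -[f z]fineK_density ?lt_eqF// lee_fin leNgt; apply/negP => fze; case: (h z).
Qed.

Lemma J_lt s t : 0 < s -> s < t -> t < 1 / 2 -> J mu f s < J mu f t.
Proof.
move=> s0 st t2.
have [|x x0 sE] := @distr_surj _ mu noatom sym s; first by apply/andP; split; lra.
have [|y y0 tE] := @distr_surj _ mu noatom sym t; first by apply/andP; split; lra.
rewrite -sE -tE !J_distr density_ltN// ltNge; apply/negP => /(le_distr noatom).
by rewrite sE tE leNgt st.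
Qed.

Variables (a m : R).
Hypothesis a01 : 0 < a < 1 / 2.
Hypothesis J2_ge0 : {in `]0, 1 / 2[, forall t, 0 <= derive1n 2 (J mu f) t}.
Hypothesis J2_ge : {in `[a, 1 / 2[, forall t, m <= derive1n 2 (J mu f) t}.

Local Notation psi := (parabola (J mu f a) (derive1 (J mu f) a) m a).

(** J is strictly increasing and lies above its tangent at a, so J(a) - J'(a) a / 2 <= J(a / 2) <
    J(a). *)
Lemma dJ_gt0 : 0 < derive1 (J mu f) a.
Proof.
have /andP[a0 a2] := a01; have t01 : 0 < a / 2 < 1 / 2 by apply/andP; split; lra.
have := le_parabola JC2 a01 t01 J2_ge0 J2_ge.
have : J mu f (a / 2) < J mu f a by apply: J_lt; lra.
rewrite /parabola; have -> : Num.max 0 (a / 2 - a) = 0 by apply: max_l; lra.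
rewrite expr0n/= mulr0 addr0 => h1 h2.
have : 0 < derive1 (J mu f) a * (a / 2) by lra.
by rewrite pmulr_lgt0// divr_gt0.
Qed.

Lemma continuous_parabola : continuous psi.
Proof.
move=> t; rewrite /parabola; apply: cvgD; [apply: cvgD|].
- exact: cvg_cst.
- by apply: cvgM; [exact: cvg_cst|apply: cvgB => //; exact: cvg_cst].
- apply: cvgM; first exact: cvg_cst.
  apply: (@continuous_comp _ _ _ (fun u => Num.max 0 (u - a)) (fun v => v ^+ 2)).
    apply: continuous_max; first exact: cvg_cst.
    by apply: cvgB => //; exact: cvg_cst.
  exact: exprn_continuous.
Qed.

(** For x < 0 this is the bound on J at F(x). At the origin, f(0) >= f(y) >= psi(F(y)) for y < 0,
    and y tends to 0. *)
Lemma le_parabola_density x : x <= 0 -> ((psi (F x))%:E <= f x)%E.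
Proof.
have psi_lt y : y < 0 -> ((psi (F y))%:E <= f y)%E.
  move=> y0; rewrite -fineK_density ?lt_eqF// lee_fin -J_distr.
  apply: (le_parabola JC2 a01 _ J2_ge0 J2_ge).
  by rewrite distr_gt0 distr_lt_half.
rewrite le_eqVlt => /predU1P[->|]; last exact: psi_lt.
have cpsi : (psi (F y))%:E @[y --> (0 : R)^'-] --> (psi (F 0))%:E.
  apply: cvg_EFin; first by near=> y.
  apply: cvg_at_left_filter; apply: (@continuous_comp _ _ _ F psi).
    exact: continuous_distr.
  exact: continuous_parabola.
apply: (cvge_to_le cpsi).
near=> y; apply: le_trans (density_le0 y); apply: psi_lt.
by near: y; exact: nbhs_left_lt.
Unshelve. all: by end_near. Qed.

Lemma le_parabola_density_right x : 0 <= x -> ((psi (1 - F x))%:E <= f x)%E.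
Proof.
move=> x0; rewrite -distrN// -density_even; apply: le_parabola_density.
by rewrite oppr_le0.
Qed.

(** Far to the left f is arbitrarily small, F is at most a, and the increasing linear part of psi
    gives psi(0) <= psi(F(z)) <= f(z). A side without an end is later counted as psi(0). *)
Lemma parabola0_le0 : psi 0 <= 0.
Proof.
have /andP[a0 a2] := a01.
rewrite -[leRHS]add0r; apply/ler_addgt0Pr => e e0; rewrite add0r.
have [x x0 fx] := density_small e0.
have [y y0 Fy] := distr_surj noatom sym a01.
(* Being left of x makes f(z) < e; being left of y makes F(z) <= a, so that the quadratic term
   vanishes. *)
pose z := Num.min x y.
have zx : z <= x by rewrite ge_min lexx.
have zy : z <= y by rewrite ge_min lexx orbT.
have z0 : z < 0 by exact: le_lt_trans zx _.
have Fz : F z <= a by rewrite -Fy le_distr.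
have fz : fr z < e.
  move: zx; rewrite le_eqVlt => /predU1P[->//|zx].
  by rewrite (lt_trans _ fx)// density_ltN.
have := le_parabola_density (ltW z0).
rewrite -fineK_density ?lt_eqF// lee_fin /parabola.
have -> : Num.max 0 (F z - a) = 0 by apply: max_l; lra.
have -> : Num.max 0 (0 - a) = 0 by apply: max_l; lra.
rewrite expr0n/= !mulr0 !addr0 => h.
have : derive1 (J mu f) a * (0 - a) <= derive1 (J mu f) a * (F z - a).
  by rewrite ler_pM2l ?dJ_gt0// lerD2r distr_ge0.
lra.
Qed.

End LogConvexDensity.

(** * Perimeter of sets and their tails *)

Section HalfLines.
Context {R : realType}.
Variables (mu : probability (measurableTypeR R) R) (f : R -> \bar R).
Hypothesis muF : classF mu f.
Implicit Types (x y z c e q b : R) (A E : set (measurableTypeR R)).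
Local Notation lam := (@lebesgue_measure R).
Local Notation F := (distr mu).

Let noatom := classF_noatom muF.
Let sym := classF_sym muF.

Lemma le_mu_setU_null A (B C : set (measurableTypeR R)) :
  measurable A -> measurable B -> measurable C ->
  mu C = 0%E -> A `<=` B `|` C -> (mu A <= mu B)%E.
Proof.
move=> mA mB mC C0 ABC; rewrite -(measureU0 mB mC C0) le_measure ?inE//.
exact: measurableU.
Qed.

(** q is the mass of the whole tail cut off by the end of A nearest to the origin, and 0 if A is
    null on the left, as if that end were at infinity. The third clause measures how far this tail
    reaches into the centre. *)
Lemma left_half A : measurable A -> left_null_or_conull A ->
  exists q, [/\ 0 <= q, (mu (A `&` [set` `]-oo, (0 : R)[%R]) <= q%:E)%E,
    forall y, y <= 0 ->
      (mu (A `&` [set` `[y, (0 : R)[%R]) <= (Num.max 0 (q - F y))%:E)%E &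
    q = 0 \/ exists x, [/\ x <= 0, q = F x,
      lam (A `&` [set` `]x, (0 : R)[%R]) = 0%E &
      exists2 e, 0 < e & lam ([set` `]x - e, x[] `\` A) = 0%E]].
Proof.
move=> mA lA; have [h|[x [x0 hx [e e0 he]]]] := left_end 0 mA lA.
  have A0 : mu (A `&` [set` `]-oo, (0 : R)[%R]) = 0%E.
    apply/eqP; rewrite eq_le measure_ge0 andbT; apply/lee_addgt0Pr => e e0.
    rewrite add0e; have [y y0 Fy] := distr_small noatom e0.
    apply: (@le_trans _ _ (mu [set` `]-oo, y]])); last first.
      by rewrite (mu_itvNy noatom) lee_fin ltW.
    apply: (le_mu_setU_null (C := A `&` [set` `]y, (0 : R)[%R])) => //;
      try exact: measurableI_itv.
      by apply: (null_mu muF); [exact: measurableI_itv|exact: h].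
    move=> z [Az]; rewrite /= !in_itv/= => ->; rewrite andbT.
    by case: (leP (z : R) y); [left|right].
  exists 0; split => //; [by rewrite A0| |by left].
  move=> y y0; apply: (@le_trans _ _ (mu (A `&` [set` `]-oo, (0 : R)[%R]))).
    rewrite le_measure ?inE//; try exact: measurableI_itv.
    by apply: setIS; apply: subset_itvr.
  by rewrite A0 lee_fin le_max lexx.
have hx0 : mu (A `&` [set` `]x, (0 : R)[%R]) = 0%E.
  by apply: (null_mu muF) => //; exact: measurableI_itv.
exists (F x); split; first exact: distr_ge0.
- rewrite -(mu_itvNy noatom false).
  apply: (le_mu_setU_null (C := A `&` [set` `]x, (0 : R)[%R])) => //;
    try exact: measurableI_itv.
  move=> z [Az]; rewrite /= !in_itv/= => ->; rewrite andbT.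
  by case: (leP (z : R) x); [left|right].
- move=> y y0; have [yx|xy] := leP y x.
    apply: (@le_trans _ _ (mu [set` `[y, x]])); last first.
      by rewrite (mu_itv noatom)// lee_fin le_max lexx orbT.
    apply: (le_mu_setU_null (C := A `&` [set` `]x, (0 : R)[%R])) => //;
      try exact: measurableI_itv.
    move=> z [Az]; rewrite /= !in_itv/= => /andP[-> ->]; rewrite andbT.
    by case: (leP (z : R) x); [left|right].
  apply: (@le_trans _ _ (mu (A `&` [set` `]x, (0 : R)[%R]))).
    rewrite le_measure ?inE//; try exact: measurableI_itv.
    by apply: setIS; apply: subset_itvr; rewrite bnd_simp.
  by rewrite hx0 lee_fin le_max lexx.
- by right; exists x; split => //; exists e.
Qed.

Lemma right_half A : measurable A -> right_null_or_conull A ->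
  exists q, [/\ 0 <= q, (mu (A `&` [set` `](0 : R), +oo[%R]) <= q%:E)%E,
    forall y, 0 <= y ->
      (mu (A `&` [set` `](0 : R), y]%R]) <= (Num.max 0 (q - F (- y)))%:E)%E &
    q = 0 \/ exists x, [/\ 0 <= x, q = 1 - F x,
      lam (A `&` [set` `](0 : R), x[]) = 0%E &
      exists2 e, 0 < e & lam ([set` `]x, x + e[] `\` A) = 0%E]].
Proof.
move=> mA rA; pose N : set (measurableTypeR R) := [set x | A (- x)].
have mN : measurable N by exact: measurable_oppr_preimage.
have muN (B C : set (measurableTypeR R)) : measurable B ->
    (forall x, C x <-> B (- x)) -> mu C = mu B.
  move=> mB CB; rewrite -[RHS](sym mB); congr (mu _); apply/seteqP; split => x.
    by move=> /CB Bx; exists (- x); rewrite ?opprK.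
  by move=> [z Bz <-]; apply/CB; rewrite opprK.
have lN : left_null_or_conull N by exact: right_null_or_conull_oppr.
have [q [q0 qA qy qx]] := left_half mN lN.
exists q; split => //.
- rewrite -(muN _ (N `&` [set` `]-oo, (0 : R)[%R])) ?qA//; first exact: measurableI_itv.
  by move=> x; rewrite /N/= !in_itv/= andbT oppr_gt0.
- move=> y y0; have := qy (- y); rewrite oppr_le0 => /(_ y0).
  rewrite (muN (A `&` [set` `](0 : R), y]%R]))//; first exact: measurableI_itv.
  by move=> x; rewrite /N/= !in_itv/= oppr_gt0 lerNl andbC.
- case: qx => [->|[x [x0 -> hx [e e0 he]]]]; [by left|right].
  exists (- x); rewrite oppr_ge0 distrN// opprB addrC subrK; split => //.
    by move: hx; rewrite lebesgue_oppr_itvI// oppr0.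
  by exists e => //; move: he; rewrite lebesgue_oppr_itvD// opprB addrC.
Qed.

End HalfLines.

(** * Perimeter bounded below by the two nearest ends *)

Section PerimeterBounds.
Context {R : realType}.
Variables (mu : probability (measurableTypeR R) R) (f : R -> \bar R).
Hypothesis muF : classF mu f.
Hypothesis JC2 : C2_on `]0, 1 / 2[%classic (J mu f).
Implicit Types (x y z c e q : R) (A E : set (measurableTypeR R)).
Local Notation lam := (@lebesgue_measure R).
Local Notation F := (distr mu).

Let noatom := classF_noatom muF.
Let sym := classF_sym muF.

Lemma finite_perimeter_isolated_boundary A :
  (perimeter f A < +oo)%E -> isolated_boundary A.
Proof.
apply: finite_perimeter_isolated; first exact: classF_ge0 muF.
exact: density_lower_bound muF JC2.
Qed.

Lemma mu_le_halves A q1 q2 : measurable A ->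
  (mu (A `&` [set` `]-oo, (0 : R)[%R]) <= q1%:E)%E ->
  (mu (A `&` [set` `](0 : R), +oo[%R]) <= q2%:E)%E -> (mu A <= (q1 + q2)%:E)%E.
Proof.
move=> mA h1 h2; rewrite EFinD; apply: le_trans (leeD h1 h2).
apply: le_trans (measureU2 _ _ _); try exact: measurableI_itv.
apply: (le_mu_setU_null (C := [set (0 : R)])) => //.
- by apply: measurableU; exact: measurableI_itv.
- move=> z Az; rewrite /= !in_itv/= andbT.
  by case: (ltgtP (z : R) 0) => h; [left; left|left; right|right].
Qed.

Lemma mu_centre_le_halves A b q1 q2 : measurable A -> 0 <= b ->
  (mu (A `&` [set` `[(- b)%R, (0 : R)[%R]) <= q1%:E)%E ->
  (mu (A `&` [set` `](0 : R), b]%R]) <= q2%:E)%E ->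
  (mu (A `&` [set` `[(- b)%R, b]%R]) <= (q1 + q2)%:E)%E.
Proof.
move=> mA b0 h1 h2; rewrite EFinD; apply: le_trans (leeD h1 h2).
apply: le_trans (measureU2 _ _ _); try exact: measurableI_itv.
apply: (le_mu_setU_null (C := [set (0 : R)])) => //.
- exact: measurableI_itv.
- by apply: measurableU; exact: measurableI_itv.
- move=> z [Az]; rewrite /= !in_itv/= => /andP[-> ->]; rewrite andbT/=.
  by case: (ltgtP (z : R) 0) => h; [left; left|left; right|right].
Qed.

Variables (a m : R).
Hypothesis a01 : 0 < a < 1 / 2.
Hypothesis J2_ge0 : {in `]0, 1 / 2[, forall t, 0 <= derive1n 2 (J mu f) t}.
Hypothesis J2_ge : {in `[a, 1 / 2[, forall t, m <= derive1n 2 (J mu f) t}.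

Local Notation psi := (parabola (J mu f a) (derive1 (J mu f) a) m a).

Lemma perimeter_ge_halves A b : measurable A -> 0 <= b ->
  (perimeter f A < +oo)%E -> ~ lebesgue_density_at A 0 1%E ->
  exists q1 q2, [/\ (mu A <= (q1 + q2)%:E)%E,
    (mu (A `&` [set` `[(- b)%R, b]%R]) <=
      (Num.max 0 (q1 - F (- b)) + Num.max 0 (q2 - F (- b)))%:E)%E &
    ((psi q1 + psi q2)%:E <= perimeter f A)%E].
Proof.
move=> mA b0 PA n1; have iA := finite_perimeter_isolated_boundary PA.
have rA := isolated_right_null_or_conull mA iA.
have [q1 [q10 q1A q1b q1x]] := left_half muF mA (isolated_left_null_or_conull mA iA).
have [q2 [q20 q2A q2b q2x]] := right_half muF mA rA.
exists q1, q2; split; first exact: mu_le_halves.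
  apply: mu_centre_le_halves => //; last exact: q2b.
  by apply: q1b; rewrite oppr_le0.
have psi0 : psi 0 <= 0 := parabola0_le0 muF JC2 a01 J2_ge0 J2_ge.
have psiL x : x <= 0 -> ((psi (F x))%:E <= f x)%E.
  exact: le_parabola_density.
have psiR x : 0 <= x -> ((psi (1 - F x))%:E <= f x)%E.
  exact: le_parabola_density_right.
(* When the end is the origin the null interval next to it is empty; density 1 is then excluded by
   [n1]. *)
have bdryL x e : x <= 0 -> lam (A `&` [set` `]x, (0 : R)[%R]) = 0%E ->
    0 < e -> lam ([set` `]x - e, x[] `\` A) = 0%E -> essential_boundary A x.
  rewrite le_eqVlt => /predU1P[-> _ e0 h|x0 h e0 h'].
    by split => //; exact: (conull_left_not_density0 mA e0 h).
  exact: (left_end_boundary mA e0 x0 h h').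
have bdryR x e : 0 <= x -> lam (A `&` [set` `](0 : R), x[%R]) = 0%E ->
    0 < e -> lam ([set` `]x, x + e[] `\` A) = 0%E -> essential_boundary A x.
  rewrite le_eqVlt => /predU1P[<- _ e0 h|x0 h e0 h'].
    by split => //; exact: (conull_right_not_density0 mA e0 h).
  exact: (right_end_boundary mA e0 x0 h h').
have P0 : (0 <= perimeter f A)%E.
  by apply: esum_ge0 => x _; exact: classF_ge0 muF _.
have P1 x c : essential_boundary A x -> (c%:E <= f x)%E ->
    (c%:E <= perimeter f A)%E.
  move=> Ax /le_trans; apply; have := @sum_le_perimeter _ f A [:: x] isT.
  by rewrite big_seq1; apply => y; rewrite inE => /eqP->.
case: q1x => [q1E|[x1 [x10 q1E l1 [e1 e10 r1]]]];
  case: q2x => [q2E|[x2 [x20 q2E l2 [e2 e20 r2]]]].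
- by rewrite q1E q2E; apply: le_trans P0; rewrite lee_fin; lra.
- apply: (P1 x2); first exact: (bdryR _ _ x20 l2 e20 r2).
  by apply: le_trans (psiR _ x20); rewrite lee_fin q1E q2E; lra.
- apply: (P1 x1); first exact: (bdryL _ _ x10 l1 e10 r1).
  by apply: le_trans (psiL _ x10); rewrite lee_fin q1E q2E; lra.
(* The perimeter must count two points. Coinciding ends could only be the origin, with A conull on
   both sides and hence of density 1 there. *)
- have x12 : x1 != x2.
    apply/eqP => x12; apply: n1.
    have x1E : x1 = 0 by apply/eqP; rewrite eq_le x10 x12 x20.
    have x2E : x2 = 0 by rewrite -x12.
    rewrite x1E in r1; rewrite x2E in r2.
    apply/lebesgue_density1C => //.
    have ee : 0 < Num.min e1 e2 by rewrite lt_min e10 e20.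
    have sub (i j : interval R) : (i <= j)%O ->
        lam ([set` j] `\` A) = 0%E -> lam (~` A `&` [set` i]) = 0%E.
      move=> ij j0; apply/eqP; rewrite eq_le measure_ge0 andbT -[leRHS]j0.
      rewrite le_measure ?inE//.
      - by apply: measurableI_itv; exact: measurableC.
      - exact: measurableD.
      - by rewrite setDE setIC; apply: setSI; apply: subitvP.
    apply: (@null_density0 _ _ _ _ (measurableC mA) ee).
      apply: sub r1; rewrite subitvE !bnd_simp lerD2l lerN2 ge_min lexx/=.
      by [].
    apply: sub r2; rewrite subitvE !bnd_simp lerD2l ge_min lexx orbT.
    by [].
  have := @sum_le_perimeter _ f A [:: x1; x2].
  rewrite /= inE x12 => /(_ isT); rewrite big_cons big_seq1 => h.
  apply: le_trans (h _); first by rewrite EFinD q1E q2E leeD ?psiL ?psiR.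
  move=> y; rewrite !inE => /orP[] /eqP->; [exact: (bdryL _ _ x10 l1 e10 r1)|
    exact: (bdryR _ _ x20 l2 e20 r2)].
Qed.

End PerimeterBounds.

(** * Gain over the parabola *)

Section Gain.
Context {R : realType}.
Variables (k k1 m a : R).
Hypotheses (k10 : 0 <= k1) (m0 : 0 <= m).
Local Notation psi := (parabola k k1 m a).
Local Notation ex := (fun q => Num.max 0 (q - a)).

(** With both q1, q2 >= a the excesses add up to q1 + q2 - 2a, which is at least lam / 2, and the
    slope term suffices. Otherwise a single excess is at least lam / 2, and m / 2 times its square
    gives m / 8. *)
Lemma parabola_gain_concentrated q1 q2 s lam : 2 * a <= q1 + q2 ->
  0 <= lam -> lam <= 2 * s -> s <= ex q1 + ex q2 ->
  k1 * (lam / 2) <= psi q1 + psi q2 - 2 * k \/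
  m / 8 * lam ^+ 2 <= psi q1 + psi q2 - 2 * k.
Proof.
rewrite /parabola /= => q12 l0 ls.
have half e : lam / 2 <= e -> m / 8 * lam ^+ 2 <= m / 2 * e ^+ 2.
  move=> le; have -> : m / 8 * lam ^+ 2 = m / 2 * (lam / 2) ^+ 2 by lra.
  by rewrite ler_wpM2l ?divr_ge0// ler_pXn2r// nnegrE; lra.
have k1q : 0 <= k1 * (q1 + q2 - 2 * a) by rewrite mulr_ge0//; lra.
have sq x : 0 <= m / 2 * x ^+ 2 by rewrite mulr_ge0 ?sqr_ge0 ?divr_ge0.
have [h1|h1] := leP a q1; have [h2|h2] := leP a q2.
- rewrite !max_r; [|lra..] => se; left.
  have := sq (q1 - a); have := sq (q2 - a).
  have : k1 * (lam / 2) <= k1 * (q1 + q2 - 2 * a) by rewrite ler_wpM2l//; lra.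
  lra.
- rewrite (max_r (x := 0) (y := q1 - a)) ?(max_l (x := 0) (y := q2 - a)); [|lra..].
  rewrite addr0 expr0n/= mulr0 => se; right.
  have := half (q1 - a) (ltac:(lra)); lra.
- rewrite (max_r (x := 0) (y := q2 - a)) ?(max_l (x := 0) (y := q1 - a)); [|lra..].
  rewrite add0r expr0n/= mulr0 => se; right.
  have := half (q2 - a) (ltac:(lra)); lra.
- by lra.
Qed.

(** d is the total excess. Since p = 2a, the slope term is at least k1 (1 - 2p); when both excesses
    count, it is k1 d. *)
Lemma parabola_gain_spread q1 q2 s p : p = 2 * a -> p <= 1 / 2 ->
  1 - p <= q1 + q2 -> 1 - p - (ex q1 + ex q2) <= s ->
  exists d, [/\ 0 <= d, 1 - 2 * s <= 2 * d &
    (1 - 2 * p <= d /\ k1 * d <= psi q1 + psi q2 - 2 * k) \/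
    k1 * (1 - 2 * p) + m / 2 * d ^+ 2 <= psi q1 + psi q2 - 2 * k].
Proof.
rewrite /parabola /= => pE p2 q12 sE; exists (ex q1 + ex q2); rewrite /=.
have sq x : 0 <= m / 2 * x ^+ 2 by rewrite mulr_ge0 ?sqr_ge0 ?divr_ge0.
have k1q : k1 * (1 - 2 * p) <= k1 * (q1 + q2 - 2 * a) by rewrite ler_wpM2l//; lra.
have e0 q : 0 <= ex q by rewrite le_max lexx.
split; [by rewrite addr_ge0 ?e0|lra|].
have [h1|h1] := leP a q1; have [h2|h2] := leP a q2.
- rewrite !max_r; [|lra..]; left; split; first lra.
  have := sq (q1 - a); have := sq (q2 - a); lra.
- rewrite (max_r (x := 0) (y := q1 - a)) ?(max_l (x := 0) (y := q2 - a)); [|lra..].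
  by rewrite addr0 expr0n/= mulr0; right; lra.
- rewrite (max_r (x := 0) (y := q2 - a)) ?(max_l (x := 0) (y := q1 - a)); [|lra..].
  by rewrite add0r expr0n/= mulr0; right; lra.
- by lra.
Qed.

Lemma weight_le2 (p lam : R) :
  0 <= p -> p <= 1 / 2 -> 0 <= lam -> lam <= 2 * p ->
  0 <= (1 - lam) ^+ 2 + (1 - 2 * p) <= 2.
Proof.
move=> p0 p2 l0 lp; have : 0 <= (1 - lam) ^+ 2 by exact: sqr_ge0.
have : (1 - lam) ^+ 2 <= 1 by rewrite expr_le1//; lra.
by move=> h1 h2; apply/andP; split; lra.
Qed.

(** The weight is at most 2 and lam^2 <= lam, so c <= k1 / 4 matches the slope gain k1 lam / 2, and
    c <= m / 32 is enough for the quadratic gain. *)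
Lemma weight_concentrated (p lam c g : R) :
  0 <= p -> p <= 1 / 2 -> 0 <= lam -> lam <= 2 * p ->
  c <= k1 / 4 -> c <= m / 32 ->
  k1 * (lam / 2) <= g \/ m / 8 * lam ^+ 2 <= g ->
  c * ((1 - lam) ^+ 2 + (1 - 2 * p)) * lam ^+ 2 <= g.
Proof.
move=> p0 p2 l0 lp ck cm gE; have l1 : lam <= 1 by lra.
have lam2_le : lam ^+ 2 <= lam by rewrite expr2 ler_piMr.
pose weight := (1 - lam) ^+ 2 + (1 - 2 * p); rewrite -/weight.
have /andP[w0 w2] : 0 <= weight <= 2 := weight_le2 p0 p2 l0 lp.
have l20 : 0 <= lam ^+ 2 by exact: sqr_ge0.
(* The sign of c is left open because [c_explicit] is not always known to be positive; a negative c
   makes the left side at most 0. *)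
have [c0|c0] := leP 0 c; last first.
  apply: (@le_trans _ _ 0).
    by rewrite -mulrA mulr_le0_ge0 ?(ltW c0)// mulr_ge0.
  case: gE; apply: le_trans; first by rewrite mulr_ge0// divr_ge0.
  by rewrite mulr_ge0// divr_ge0.
have : c * weight * lam ^+ 2 <= c * 2 * lam ^+ 2.
  by rewrite ler_wpM2r// ler_wpM2l.
move=> /le_trans; apply; case: gE => /(le_trans _); apply.
  apply: (@le_trans _ _ (k1 / 4 * 2 * lam)); last by lra.
  apply: ler_pM => //; [by rewrite mulr_ge0|by rewrite ler_pM2r].
by rewrite ler_wpM2r//; lra.
Qed.

(** For p < 1/2, 1 - lam <= 2d and lam^2 <= 1. In the slope case the weight is at most 2d + d = 3d;
    in the other case its two summands are matched separately with the two terms of the gain. For p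
    = 1/2 the asymmetry may come from the inner set; then lam <= 2d and the weight is at most 1. *)
Lemma weight_spread (p lam c g s d : R) :
  0 <= p -> p <= 1 / 2 -> 0 <= lam -> lam <= 2 * p ->
  c <= k1 / 4 -> c <= m / 32 ->
  0 <= d -> 1 - 2 * s <= 2 * d ->
  (p < 1 / 2 /\ lam = 2 * s) \/ (p = 1 / 2 /\ lam <= 1 - 2 * s) ->
  (1 - 2 * p <= d /\ k1 * d <= g) \/
    k1 * (1 - 2 * p) + m / 2 * d ^+ 2 <= g ->
  c * ((1 - lam) ^+ 2 + (1 - 2 * p)) * lam ^+ 2 <= g.
Proof.
move=> p0 p2 l0 lp ck cm d0 sd lE gE; have l1 : lam <= 1 by lra.
have lam2_le : lam ^+ 2 <= lam by rewrite expr2 ler_piMr.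
pose weight := (1 - lam) ^+ 2 + (1 - 2 * p); rewrite -/weight.
have /andP[w0 w2] : 0 <= weight <= 2 := weight_le2 p0 p2 l0 lp.
have l20 : 0 <= lam ^+ 2 by exact: sqr_ge0.
have p1 : 0 <= 1 - 2 * p by lra.
have [c0|c0] := leP 0 c; last first.
  apply: (@le_trans _ _ 0).
    by rewrite -mulrA mulr_le0_ge0 ?(ltW c0)// mulr_ge0.
  case: gE => [[_]|]; apply: le_trans; first by rewrite mulr_ge0.
  by rewrite addr_ge0// mulr_ge0// ?sqr_ge0 ?divr_ge0.
have l21 : lam ^+ 2 <= 1 by apply: le_trans lam2_le _; lra.
case: lE => [[_ lE]|[pE lE]]; last first.
  have w1 : weight <= 1.
    have : (1 - lam) ^+ 2 <= 1 by rewrite expr_le1//; lra.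
    rewrite /weight; lra.
  have : c * weight * lam ^+ 2 <= c * 1 * lam ^+ 2.
    by rewrite ler_wpM2r// ler_wpM2l.
  rewrite mulr1 => /le_trans; apply; case: gE => [[_]|].
    apply: le_trans; apply: (@le_trans _ _ (k1 / 4 * lam)).
      by apply: ler_pM.
    have : k1 / 4 * lam <= k1 / 4 * (2 * d) by rewrite ler_wpM2l ?divr_ge0//; lra.
    have := mulr_ge0 k10 d0; lra.
  have -> : k1 * (1 - 2 * p) = 0 by rewrite pE; lra.
  rewrite add0r; apply: le_trans.
  apply: (@le_trans _ _ (m / 32 * (2 * d) ^+ 2)).
    by apply: ler_pM => //; rewrite ler_pXn2r// ?nnegrE; lra.
  have : 0 <= m * d ^+ 2 by rewrite mulr_ge0 ?sqr_ge0.
  lra.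
apply: (@le_trans _ _ (c * weight)).
  by rewrite ler_piMr// mulr_ge0.
have l1d : 1 - lam <= 2 * d by lra.
have l10 : 0 <= 1 - lam by lra.
case: gE => [[pd]|]; apply: le_trans.
  have : (1 - lam) ^+ 2 <= 1 - lam by rewrite expr2 ler_piMr//; lra.
  move=> h; apply: (@le_trans _ _ (k1 / 4 * (3 * d))).
    by apply: ler_pM => //; rewrite /weight; lra.
  have := mulr_ge0 k10 d0; lra.
rewrite mulrDr addrC; apply: lerD.
  apply: (@le_trans _ _ (k1 / 4 * (1 - 2 * p))); first by rewrite ler_wpM2r.
  have := mulr_ge0 k10 p1; lra.
apply: (@le_trans _ _ (m / 32 * (2 * d) ^+ 2)).
  by apply: ler_pM; rewrite ?sqr_ge0// ler_pXn2r// ?nnegrE; lra.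
have : 0 <= m * d ^+ 2 by rewrite mulr_ge0 ?sqr_ge0.
lra.
Qed.

End Gain.

(** * Tails, deficit and asymmetry *)

Section OuterSet.
Context {R : realType}.
Variables (mu : probability (measurableTypeR R) R) (f : R -> \bar R).
Hypothesis muF : classF mu f.
Hypothesis JC2 : C2_on `]0, 1 / 2[%classic (J mu f).
Implicit Types (x y z c e q b p : R) (A E : set (measurableTypeR R)).
Local Notation lam := (@lebesgue_measure R).
Local Notation F := (distr mu).

Let noatom := classF_noatom muF.
Let sym := classF_sym muF.

Definition tails b : set (measurableTypeR R) :=
  [set` `]-oo, (- b)[] `|` [set` `]b, +oo[].

Lemma measurable_tails b : measurable (tails b).
Proof. exact: measurableU. Qed.

Lemma tailsC b : ~` tails b = [set` `[- b, b]].
Proof.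
apply/seteqP; split => x /=; rewrite /tails/= !in_itv/= andbT.
  move=> /not_orP[/negP + /negP]; rewrite -!leNgt.
  by move=> -> ->.
by move=> /andP[bx xb] []; [rewrite ltNge bx|rewrite ltNge xb].
Qed.

Lemma outerE p : 0 < p < 1 -> exists b,
  [/\ 0 < b, F (- b) = p / 2, distr_inv mu (p / 2) = (- b)%:E &
      outer mu p = tails b].
Proof.
move=> /andP[p0 p1].
have [|x x0 xE] := @distr_surj _ mu noatom sym (p / 2).
  by apply/andP; split; lra.
have xI : distr_inv mu (p / 2) = x%:E by rewrite -xE (distr_invK muF).
exists (- x); rewrite opprK oppr_gt0; split => //.
rewrite /outer /beta xI oppeK; apply/seteqP.
by split => y /=; rewrite /tails/= !in_itv/= !lte_fin opprK andbT.
Qed.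

(** At p = 1/2 alpha and beta coincide, so the inner set is, up to two points, the complement of the
    outer one. *)
Lemma inner_half b : distr_inv mu (1 / 2 / 2) = (- b)%:E ->
  inner mu (1 / 2) = [set` `]- b, b[].
Proof.
move=> bI; rewrite /inner /alpha /beta (_ : (1 - 1 / 2) / 2 = 1 / 2 / 2); last lra.
rewrite bI /= !opprK; apply/seteqP; split => y /=; rewrite !in_itv/= !lte_fin.
  by move=> [-> ->].
by move=> /andP[].
Qed.

(** An inclusion is enough: a lower bound on the deficit needs the perimeter of the tails bounded
    from above. *)
Lemma essential_boundary_tails b : 0 < b ->
  essential_boundary (tails b) `<=` [set` [:: - b; b]].
Proof.
move=> b0 x [n0 n1]; rewrite /= !inE; apply: contrapT => /negP.
rewrite negb_or => /andP[xNb xb].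
have [bx|bx] := ltP `|x| b.
  have e0 : 0 < b - `|x| by rewrite subr_gt0.
  have sub y : x - (b - `|x|) < y < x + (b - `|x|) -> ~ tails b y.
    move=> /andP[h1 h2]; have := ler_norm x; have := ler_norm (- x).
    rewrite normrN => h3 h4.
    by rewrite /tails/= !in_itv/= andbT => -[|]; lra.
  apply: n0; apply: (null_density0 (measurable_tails b) e0);
    rewrite [X in lam X](_ : _ = set0) ?measure0//; apply/seteqP; split => // y [];
    rewrite /= in_itv/= => ty /andP[h1 h2]; apply: (sub y) => //;
    apply/andP; split; lra.
have {}bx : b < `|x|.
  rewrite lt_neqAle bx andbT; apply/eqP => bE.
  have [x0|x0] := ltP x 0.
    by move: xNb; rewrite bE ltr0_norm// opprK eqxx.
  by move: xb; rewrite bE ger0_norm// eqxx.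
have e0 : 0 < `|x| - b by rewrite subr_gt0.
apply: n1; apply/lebesgue_density1C; first exact: measurable_tails.
have sub y : x - (`|x| - b) < y < x + (`|x| - b) -> ~ (~` tails b) y.
  move=> /andP[h1 h2]; rewrite tailsC /= in_itv/= => /andP[h3 h4].
  have [x0|x0] := ltP x 0; last by rewrite ger0_norm// in h1; lra.
  by rewrite ltr0_norm// in h2; lra.
apply: (null_density0 (measurableC (measurable_tails b)) e0);
  rewrite [X in lam X](_ : _ = set0) ?measure0//; apply/seteqP; split => // y [];
  rewrite /= in_itv/= => ty /andP[h1 h2]; apply: (sub y) => //;
  apply/andP; split; lra.
Qed.

Lemma perimeter_tails b : 0 < b ->
  (perimeter f (tails b) <= (2 * J mu f (F (- b)))%:E)%E.
Proof.
move=> b0; have Nb0 : - b != 0 by rewrite oppr_eq0 gt_eqF.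
have us : uniq [:: - b; b].
  by rewrite /= inE andbT -subr_eq0 -opprD oppr_eq0 gt_eqF// addr_gt0.
apply: (@le_trans _ _ (\esum_(x in [set` [:: - b; b]]) f x)).
  apply: le_ereal_sup => _ [X [finX XS] <-]; exists X => //; split => //.
  exact: subset_trans XS (essential_boundary_tails b0).
rewrite esum_fset; [|exact: finite_seq|by move=> i _; exact: classF_ge0 muF _].
rewrite -fsbig_seq// big_cons big_seq1 (density_even muF JC2) J_distr//.
rewrite mulr_natl mulr2n EFinD (fineK_density muF Nb0).
by rewrite (density_even muF JC2).
Qed.

Variables (E : set (measurableTypeR R)) (p b : R).
Hypotheses (mE : measurable E) (muE : mu E = p%:E) (b0 : 0 < b).
Hypotheses (Fb : F (- b) = p / 2) (bI : distr_inv mu (p / 2) = (- b)%:E).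
Hypothesis outE : outer mu p = tails b.

Let s := fine (mu (E `&` [set` `[- b, b]])).

Lemma mu_tails : mu (tails b) = p%:E.
Proof.
rewrite measureU//=.
- rewrite [X in (X + _)%E](mu_itvNy noatom) [X in (_ + X)%E](mu_itvy noatom).
  rewrite -EFinD -(distrN noatom sym) Fb; congr EFin; lra.
- apply/seteqP; split => // x [] /=; rewrite !in_itv/= andbT => h1 h2.
  have := lt_trans h2 h1; rewrite ltNge => /negP; apply.
  by rewrite (le_trans _ (ltW b0))// oppr_le0 ltW.
Qed.

Let sE : mu (E `\` tails b) = s%:E.
Proof.
rewrite setDE tailsC fineK// prob_fin_num//; exact: measurableI_itv.
Qed.

(** E and the tails have the same mass p, hence the two halves of the symmetric difference have
    equal mass. *)
Lemma mu_setY_tails : fine (mu (E `+` tails b)) = 2 * s.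
Proof.
have mT := measurable_tails b.
rewrite /setY measureU/=; [|exact: measurableD|exact: measurableD|]; last first.
  by apply/seteqP; split => // x [[Ex nx] [tx nE]].
have mEI : measurable (E `&` tails b) by exact: measurableI.
have mTE : measurable (tails b `\` E) by exact: measurableD.
have /= := measureDI mu mE mT; have /= := measureDI mu mT mE.
rewrite mu_tails muE sE setIC.
rewrite -(fineK (prob_fin_num mu mEI)) -(fineK (prob_fin_num mu mTE)).
rewrite -!EFinD => -[h1] [h2] /=; lra.
Qed.

Lemma asymmetry_lt_half : p < 1 / 2 -> asymmetry mu E = 2 * s.
Proof.
by move=> p2; rewrite /asymmetry /mass muE/= p2 outE mu_setY_tails.
Qed.

(** Up to the points -b and b, the symmetric difference with the inner set is the complement of the
    one with the tails, of mass 1 - 2s. *)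
Lemma asymmetry_half : p = 1 / 2 ->
  asymmetry mu E <= 2 * s /\ asymmetry mu E <= 1 - 2 * s.
Proof.
move=> p2; rewrite /asymmetry /mass muE/= p2 ltxx -p2 outE mu_setY_tails.
split; first by rewrite ge_min lexx.
rewrite ge_min; apply/orP; right.
have mT := measurable_tails b.
have mET : measurable (E `+` tails b) by apply: measurableU; exact: measurableD.
rewrite -mu_setY_tails -lee_fin EFinB fineK; last first.
  rewrite prob_fin_num//.
  by apply: measurableU; apply: measurableD => //;
    rewrite p2 (inner_half (b := b)) -?p2//; exact: measurable_itv.
rewrite (fineK (prob_fin_num mu mET)) -(probability_setC mu mET).
rewrite p2 (inner_half (b := b)) -?p2//.
apply: (@le_mu_setU_null _ mu _ _ ([set - b] `|` [set b])).
- by apply: measurableU; apply: measurableD => //; exact: measurable_itv.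
- exact: measurableC.
- exact: measurableU.
- by apply: eq_trans (noatom (- b)); apply: measureU0 => //; exact: noatom.
- move=> x; have [xb|xb] := eqVneq (x : R) b; first by move=> _; right; right.
  have [xNb|xNb] := eqVneq (x : R) (- b); first by move=> _; right; left.
  have iT : `]- b, b[%classic x <-> ~ tails b x.
    rewrite -[~ _]/((~` tails b) x) tailsC /= !in_itv/=.
    by rewrite !lt_neqAle (eq_sym (- b)) xNb xb.
  move=> h; left => -[[Ex tx]|[tx nE]].
    by case: h => -[]; [move=> _ /iT|move=> /iT].
  by case: h => -[]; [|move=> /iT].
Qed.

End OuterSet.

(** * The deficit inequalities for a general constant *)

Section DeficitBounds.
Context {R : realType}.
Variables (mu : probability (measurableTypeR R) R) (f : R -> \bar R).
Hypothesis muF : classF mu f.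
Hypothesis JC2 : C2_on `]0, 1 / 2[%classic (J mu f).
Hypothesis J2_ge0 : {in `]0, 1 / 2[, forall t, 0 <= derive1n 2 (J mu f) t}.
Implicit Types (x y z c e q b : R) (A E : set (measurableTypeR R)).

Lemma perimeter_ge0 (E : set R) : (0 <= perimeter f E)%E.
Proof. by apply: esum_ge0 => x _; exact: classF_ge0 muF _. Qed.

Lemma perimeter_outer_fin_num p : 0 < p < 1 ->
  perimeter f (outer mu p) \is a fin_num.
Proof.
move=> p01; have [b [b0 _ _ ->]] := outerE muF p01.
rewrite ge0_fin_numE ?perimeter_ge0//.
exact: le_lt_trans (perimeter_tails muF JC2 b0) (ltry _).
Qed.

Lemma deficit_pinfty E p : 0 < p < 1 -> mu E = p%:E ->
  perimeter f E = +oo%E -> deficit mu f E = +oo%E.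
Proof.
move=> p01 muE PE; rewrite /deficit /mass muE PE/=.
by rewrite -(fineK (perimeter_outer_fin_num p01)).
Qed.

Lemma deficit_ge E p r : 0 < p < 1 -> mu E = p%:E ->
  (r%:E <= perimeter f E)%E ->
  ((r - 2 * J mu f (p / 2))%:E <= deficit mu f E)%E.
Proof.
move=> p01 muE rE; rewrite /deficit /mass muE/=.
have [b [b0 Fb _ ->]] := outerE muF p01.
rewrite EFinB leeB//; have := perimeter_tails muF JC2 b0.
by rewrite Fb.
Qed.

Lemma asymmetry_ge0 E : 0 <= asymmetry mu E.
Proof.
rewrite /asymmetry; case: ifPn => _; first exact: fine_ge0.
by rewrite le_min !fine_ge0.
Qed.

Variables (p m : R).
Hypothesis p0 : 0 < p.
Hypothesis p2 : p <= 1 / 2.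
Hypothesis m0 : 0 <= m.
Hypothesis J2_ge : {in `[p / 2, 1 / 2[, forall t, m <= derive1n 2 (J mu f) t}.

Local Notation k := (J mu f (p / 2)).
Local Notation k1 := (derive1 (J mu f) (p / 2)).

Let p01 : 0 < p < 1.
Proof. by move: p0 p2 => ? ?; apply/andP; split; lra. Qed.

Let a01 : 0 < p / 2 < 1 / 2.
Proof. by move: p0 p2 => ? ?; apply/andP; split; lra. Qed.

Let k10 : 0 <= k1.
Proof. exact/ltW/(dJ_gt0 muF JC2 a01 J2_ge0 J2_ge). Qed.

Lemma asymmetry_le E b : measurable E -> mu E = p%:E -> 0 < b ->
  distr mu (- b) = p / 2 -> distr_inv mu (p / 2) = (- b)%:E ->
  outer mu p = tails b ->
  asymmetry mu E <= 2 * fine (mu (E `&` [set` `[- b, b]])).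
Proof.
move=> mE muE b0 Fb bI oE; move: p2; rewrite le_eqVlt => /predU1P[pE|plt].
  by have [] := asymmetry_half muF mE muE b0 Fb bI oE pE.
by rewrite (asymmetry_lt_half muF mE muE b0 Fb oE plt).
Qed.

Lemma deficit_concentrated E : measurable E -> mu E = p%:E ->
  (perimeter f E < +oo)%E -> ~ lebesgue_density_at E 0 1%E ->
  exists2 g : R, (g%:E <= deficit mu f E)%E &
    k1 * (asymmetry mu E / 2) <= g \/ m / 8 * asymmetry mu E ^+ 2 <= g.
Proof.
move=> mE muE PE n1; have [b [b0 Fb bI oE]] := outerE muF p01.
have [q1 [q2 [qE qb qP]]] :=
  perimeter_ge_halves muF JC2 a01 J2_ge0 J2_ge mE (ltW b0) PE n1.
exists (parabola k k1 m (p / 2) q1 + parabola k k1 m (p / 2) q2 - 2 * k).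
  exact: deficit_ge.
apply: (parabola_gain_concentrated k k10 m0).
- by move: qE; rewrite muE lee_fin => /(le_trans _); apply; lra.
- exact: asymmetry_ge0.
- exact: asymmetry_le oE.
- rewrite -lee_fin -Fb fineK// prob_fin_num//; exact: measurableI_itv.
Qed.

Lemma bound_concentrated E lam c : 0 <= lam <= 2 * p ->
  c <= k1 / 4 -> c <= m / 32 ->
  measurable E -> mu E = p%:E -> asymmetry mu E = lam ->
  ~ lebesgue_density_at E 0 1%E ->
  ((c * ((1 - lam) ^+ 2 + (1 - 2 * p)) * lam ^+ 2)%:E <= deficit mu f E)%E.
Proof.
move=> /andP[l0 lp] ck cm mE muE lamE n1.
have [PE|PE] := ltP (perimeter f E) +oo%E; last first.
  by rewrite (deficit_pinfty p01 muE) ?leey//; apply/eqP; rewrite -leye_eq.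
have [g gE gl] := deficit_concentrated mE muE PE n1.
apply: le_trans gE; rewrite lee_fin; rewrite lamE in gl.
exact: (weight_concentrated k10 m0 (ltW p0)).
Qed.

(* The complement of E has the same essential boundary, and density 0 at the
   origin. *)
Lemma bound_spread E lam c : 0 <= lam <= 2 * p ->
  c <= k1 / 4 -> c <= m / 32 ->
  measurable E -> mu E = p%:E -> asymmetry mu E = lam ->
  lebesgue_density_at E 0 1%E ->
  ((c * ((1 - lam) ^+ 2 + (1 - 2 * p)) * lam ^+ 2)%:E <= deficit mu f E)%E.
Proof.
move=> /andP[l0 lp] ck cm mE muE lamE d1.
have [PE|PE] := ltP (perimeter f E) +oo%E; last first.
  by rewrite (deficit_pinfty p01 muE) ?leey//; apply/eqP; rewrite -leye_eq.
have mC := measurableC mE.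
have [b [b0 Fb bI oE]] := outerE muF p01.
have PC : perimeter f (~` E) = perimeter f E.
  by rewrite /perimeter essential_boundaryC.
have nC : ~ lebesgue_density_at (~` E) 0 1%E.
  move=> /(lebesgue_density0C 0 mE); rewrite lebesgue_density_atE//.
  move: d1; rewrite lebesgue_density_atE// => d1 d0.
  have /eqP : (1 : R) = 0 by apply: cvg_unique d1 d0; exact: Rhausdorff.
  by rewrite oner_eq0.
have PC_fin : (perimeter f (~` E) < +oo)%E by rewrite PC.
have [q1 [q2 [qE qb]]] :=
  perimeter_ge_halves muF JC2 a01 J2_ge0 J2_ge mC (ltW b0) PC_fin nC.
rewrite PC => qP.
set s := fine (mu (E `&` [set` `[- b, b]])).
have h1 : 1 - p <= q1 + q2.
  by move: qE; rewrite probability_setC// muE -EFinB lee_fin.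
(* The centre [[- b, b]] has mass 1 - p; its part outside E is at most the total excess of the
   complement, and the rest is s. *)
have h2 : 1 - p - (Num.max 0 (q1 - p / 2) + Num.max 0 (q2 - p / 2)) <= s.
  have mI := measurable_itv `[- b, b].
  have muI : mu [set` `[- b, b]] = (1 - p)%:E.
    rewrite -tailsC probability_setC; last exact: measurable_tails.
    by rewrite (mu_tails muF b0 Fb).
  have /= := measureDI mu mI mE; rewrite muI setDE setIC (setIC [set` _] E).
  have mCI := measurableI_itv `[- b, b] mC.
  rewrite -(fineK (prob_fin_num mu mCI)).
  rewrite -(fineK (prob_fin_num mu (measurableI_itv `[- b, b] mE))) -/s.
  move: qb; rewrite Fb -(fineK (prob_fin_num mu mCI)) lee_fin.
  by rewrite -EFinD => h3 [h4]; lra.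
have [d [d0 sd gE]] := parabola_gain_spread k k10 m0
  (ltac:(lra) : p = 2 * (p / 2)) p2 h1 h2.
have := deficit_ge p01 muE qP; apply: le_trans; rewrite lee_fin.
apply: (weight_spread k10 m0 (ltW p0) p2 l0 lp ck cm d0 sd) gE.
rewrite -lamE; move: p2; rewrite le_eqVlt => /predU1P[pE|plt]; [right|left].
  by split => //; have [] := asymmetry_half muF mE muE b0 Fb bI oE pE.
by split => //; rewrite (asymmetry_lt_half muF mE muE b0 Fb oE plt).
Qed.

Lemma bound_i_of_le lam c : 0 <= lam <= 2 * p -> c <= k1 / 4 -> c <= m / 32 ->
  bound_i mu f p lam c.
Proof.
move=> lp ck cm E mE muE lamE.
have [d1|n1] := pselect (lebesgue_density_at E 0 1%E).
  exact: bound_spread.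
exact: bound_concentrated.
Qed.

(** In the slope case lam^2 <= 2 p lam, so c <= k1 / (4p) turns the gain k1 lam / 2 into c lam^2. *)
Lemma bound_ii_of_le lam c : 0 <= lam <= 2 * p ->
  c <= k1 / (4 * p) -> c <= m / 8 -> bound_ii mu f p lam c.
Proof.
move=> /andP[l0 lp] ck cm E mE n1 muE lamE.
have [PE|PE] := ltP (perimeter f E) +oo%E; last first.
  by rewrite (deficit_pinfty p01 muE) ?leey//; apply/eqP; rewrite -leye_eq.
have [g gE gl] := deficit_concentrated mE muE PE n1.
apply: le_trans gE; rewrite lee_fin; rewrite lamE in gl.
case: gl; apply: le_trans; last by rewrite ler_wpM2r// sqr_ge0.
rewrite ler_pdivlMr ?mulr_gt0// in ck.
(* c may be negative here, and lam^2 can be enlarged only under a nonnegative factor. *)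
have : c * lam ^+ 2 <= Num.max 0 c * (lam * (2 * p)).
  rewrite expr2; apply: le_trans (_ : Num.max 0 c * (lam * lam) <= _).
    by rewrite ler_wpM2r ?mulr_ge0// le_max lexx orbT.
  by rewrite ler_wpM2l ?le_max ?lexx// ler_wpM2l.
move=> /le_trans; apply.
have -> : Num.max 0 c * (lam * (2 * p)) = Num.max 0 c * (4 * p) * (lam / 2) by lra.
rewrite ler_wpM2r ?divr_ge0//.
by have [c0|c0] := leP 0 c => //; rewrite mul0r.
Qed.

End DeficitBounds.

(** * Explicit constants *)

(** The slope s of the chord separates the two derivatives: the graph lies above the chord, so left
    difference quotients at y are at most s and right ones at x at least s. *)
Lemma concave_derive1_nonincreasing (R : realType) (g : R -> R) (u v x y : R) :
  concave_on `]u, v[%classic g ->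
  {in `]u, v[, forall t, derivable g t 1} ->
  u < x -> x < y -> y < v -> derive1 g y <= derive1 g x.
Proof.
move=> cg dg ux xy yv; pose s := (g y - g x) / (y - x).
have xuv : x \in `]u, v[ by rewrite in_itv/= ux (lt_trans xy).
have yuv : y \in `]u, v[ by rewrite in_itv/= yv (lt_trans ux).
have yx0 : 0 < y - x by rewrite subr_gt0.
have chord t : x <= t -> t <= y -> g x + s * (t - x) <= g t.
  move=> xt ty; pose r := (t - x) / (y - x).
  have r01 : 0 <= r <= 1.
    by rewrite divr_ge0 ?subr_ge0//= ?ler_pdivrMr ?mul1r ?lerD2r// ltW.
  have := cg _ _ _ xuv yuv r01.
  have -> : (1 - r) * x + r * y = t.
    have : r * (y - x) = t - x by rewrite /r divfK// gt_eqF.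
    lra.
  apply: le_trans; rewrite /s /r; lra.
have dcvg z : z \in `]u, v[ ->
    h^-1 *: (g (h + z) - g z) @[h --> 0^'] --> derive1 g z.
  move=> /dg dz; rewrite derive1E; apply: cvg_trans dz.
  by apply: near_eq_cvg; near=> h; rewrite /= [h *: 1]mulr1.
apply: (@le_trans _ _ s).
  apply: (cvgr_to_le (cvg_dnbhs_at_left (dcvg _ yuv))); near=> h.
  have h0 : h < 0 by near: h; exact: nbhs_left_lt.
  have hx : x < h + y.
    by rewrite -ltrBlDr; near: h; apply: nbhs_left_gt; rewrite subr_lt0.
  have := chord (h + y) (ltW hx); rewrite gerDr => /(_ (ltW h0)) H.
  rewrite /GRing.scale/= mulrC ler_ndivrMr//.
  have sE : s * (y - x) = g y - g x by rewrite /s divfK// gt_eqF.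
  lra.
apply: (cvgr_to_ge (cvg_dnbhs_at_right (dcvg _ xuv))); near=> h.
have h0 : 0 < h by near: h; exact: nbhs_right_gt.
have hy : h + x < y.
  by rewrite -ltrBrDr; near: h; apply: nbhs_right_lt; rewrite subr_gt0.
have := chord (h + x); rewrite lerDr addrK => /(_ (ltW h0) (ltW hy)) H.
by rewrite /GRing.scale/= mulrC ler_pdivlMr//; lra.
Unshelve. all: by end_near. Qed.

Section Constants.
Context {R : realType}.
Variables (mu : probability (measurableTypeR R) R) (f : R -> \bar R).
Hypothesis muF : classF mu f.
Hypothesis JC2 : C2_on `]0, 1 / 2[%classic (J mu f).
Hypothesis M_gt0 : forall p : R, 0 < p <= 1 / 2 -> 0 < Minf mu f p.
Implicit Types (p t lam c : R).
Local Notation Jm := (J mu f).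
Local Notation F := (distr mu).

(** A set without infimum has [inf] equal to 0 by default; positivity of M(p) rules this out and
    makes it a genuine lower bound. *)
Lemma Minf_le p t : 0 < p <= 1 / 2 -> p / 2 <= t < 1 / 2 ->
  Minf mu f p <= derive1n 2 Jm t.
Proof.
move=> p01 pt; have := M_gt0 p01; rewrite /Minf; set S := (X in inf X) => S0.
have [[_ lbS]|nS] := pselect (has_inf S); last by rewrite inf_out ?ltxx in S0.
apply: ge_inf => //; exists t => //; split => //.
by move: p01 pt => /andP[? ?] /andP[? ?]; lra.
Qed.

Lemma J2_gt0 : {in `]0, 1 / 2[, forall t, 0 < derive1n 2 Jm t}.
Proof.
(* p is chosen so that t belongs to [p/2, 1/2) while p stays at most 1/2. *)
move=> t; rewrite in_itv/= => /andP[t0 t2]; pose p := Num.min (2 * t) (1 / 2).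
have p01 : 0 < p <= 1 / 2
  by rewrite lt_min ge_min lexx orbT andbT; apply/andP; split; lra.
apply: lt_le_trans (M_gt0 p01) (Minf_le p01 _).
have : p <= 2 * t by rewrite ge_min lexx.
by move=> ?; apply/andP; split; lra.
Qed.

Let J2_ge0 : {in `]0, 1 / 2[, forall t, 0 <= derive1n 2 Jm t}.
Proof. by move=> t /J2_gt0/ltW. Qed.

Lemma dJ_pos t : 0 < t < 1 / 2 -> 0 < derive1 Jm t.
Proof.
move=> t01; apply: (dJ_gt0 muF JC2 t01 J2_ge0 (m := 0)) => s.
rewrite in_itv/= => /andP[ts s2]; apply: J2_ge0.
by rewrite in_itv/= s2 andbT; move: t01 => /andP[]; lra.
Qed.

Lemma tangent_le t s : 0 < t < 1 / 2 -> 0 < s < 1 / 2 ->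
  Jm t + derive1 Jm t * (s - t) <= Jm s.
Proof.
move=> t01 s01; have := le_parabola JC2 t01 s01 J2_ge0 (m := 0).
rewrite /parabola mul0r mul0r addr0; apply => u.
rewrite in_itv/= => /andP[tu u2]; apply: J2_ge0.
by rewrite in_itv/= u2 andbT; move: t01 => /andP[]; lra.
Qed.

Lemma dJ_le s t : 0 < s -> s <= t -> t < 1 / 2 -> derive1 Jm s <= derive1 Jm t.
Proof.
move=> s0; rewrite le_eqVlt => /predU1P[->//|st] t2.
have h1 := tangent_le (t := s) (s := t); have h2 := tangent_le (t := t) (s := s).
have s01 : 0 < s < 1 / 2 by apply/andP; split; lra.
have t01 : 0 < t < 1 / 2 by apply/andP; split; lra.
have : derive1 Jm s * (t - s) <= derive1 Jm t * (t - s).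
  have := h1 s01 t01; have := h2 t01 s01; lra.
by rewrite ler_pM2r// subr_gt0.
Qed.

(** At p = 0 the constraint forces lam = 0, and beta is +oo, so the reference set is empty and the
    deficit is the perimeter. *)
Lemma bound_i0 lam c : 0 <= lam <= 2 * 0 -> bound_i mu f 0 lam c.
Proof.
rewrite mulr0 -eq_le => /eqP <- E mE muE _.
rewrite expr0n/= mulr0 /deficit /mass muE/=.
have -> : outer mu 0 = set0.
  rewrite /outer /beta /distr_inv mul0r eqxx/=.
  by apply/seteqP; split => // x [|]/=; rewrite ?ltNge ?leNye ?leey.
have -> : perimeter f set0 = 0%E.
  rewrite /perimeter (_ : essential_boundary set0 = set0) ?esum_set0//.
  apply/seteqP; split => // x [n0 _]; apply: n0.
  apply: (@null_density0 _ _ _ 1) => //; by rewrite set0I measure0.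
rewrite oppe0 adde0; exact: (perimeter_ge0 muF).
Qed.

Lemma bound_i_min p lam c : 0 <= p <= 1 / 2 -> 0 <= lam <= 2 * p ->
  c <= derive1 Jm (p / 2) / 4 -> c <= Minf mu f p / 32 -> bound_i mu f p lam c.
Proof.
move=> /andP[]; rewrite le_eqVlt => /predU1P[<- _|p0 p2] lp ck cm.
  exact: bound_i0.
have p01 : 0 < p <= 1 / 2 by rewrite p0.
apply: (bound_i_of_le muF JC2 J2_ge0 p0 p2 (ltW (M_gt0 p01)) _ lp ck cm).
by move=> t; rewrite in_itv/=; exact: Minf_le.
Qed.

(** Take the parabola at 1/4 with m = M(1/2): J(1/2) >= J(1/4) + J'(1/4)/4 + m/32, while psi(0) <= 0
    says J'(1/4)/4 >= J(1/4). The difference is at least m/32. *)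
Lemma J_half_gt : (f 0%R < +oo)%E -> 0 < Jm (1 / 2) - 2 * Jm (1 / 4).
Proof.
move=> f0; have a01 : 0 < (1 / 4 : R) < 1 / 2 by apply/andP; split; lra.
have p01 : 0 < (1 / 2 : R) <= 1 / 2 by apply/andP; split; lra.
have mge : {in `[1 / 4, 1 / 2[, forall t, Minf mu f (1 / 2) <= derive1n 2 Jm t}.
  move=> t; rewrite in_itv/= => t01; apply: Minf_le => //.
  by move: t01 => /andP[? ?]; apply/andP; split; lra.
have := parabola0_le0 muF JC2 a01 J2_ge0 mge.
have := le_parabola_density muF JC2 a01 J2_ge0 mge (lexx 0).
have f0fin : f 0 \is a fin_num by rewrite ge0_fin_numE//; exact: classF_ge0 muF _.
rewrite -(fineK f0fin) lee_fin -(J_distr muF).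
rewrite (distr0 (classF_noatom muF) (classF_sym muF)).
rewrite /parabola.
have -> : Num.max 0 (1 / 2 - 1 / 4) = 1 / 4 :> R by rewrite max_r; lra.
have -> : Num.max 0 (0 - 1 / 4) = 0 :> R by rewrite max_l; lra.
have := M_gt0 p01; rewrite expr0n/= mulr0; lra.
Qed.

Lemma dJ_half_ge t : 0 < t < 1 / 2 -> ((derive1 Jm t)%:E <= dJ_half mu f)%E.
Proof.
move=> /andP[t0 t2]; rewrite /dJ_half.
(* J' is nondecreasing, so the limit in [dJ_half] exists; the reflection s -> -s makes it a right
   limit of a monotone function. *)
have cv : cvg ((derive1 Jm s)%:E @[s --> (1 / 2 : R)^'-]).
  have : cvg ((derive1 Jm (- s))%:E @[s --> (- (1 / 2) : R)^'+]).
    apply: nonincreasing_at_right_is_cvge; near=> x => r s.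
    rewrite !in_itv/= => /andP[hr rx] /andP[hs sx] rs; rewrite lee_fin.
    have x0 : x < 0 by near: x; apply: nbhs_right_lt; lra.
    apply: dJ_le; lra.
  move=> /cvg_ex[l hl]; apply/cvg_ex; exists l.
  exact/(cvg_at_leftNP (fun s => (derive1 Jm s)%:E)).
apply: lime_ge => //; near=> s; rewrite lee_fin.
have ts : t < s by near: s; exact: nbhs_left_gt.
have s2 : s < 1 / 2 by near: s; exact: nbhs_left_lt.
by apply: dJ_le => //; exact: ltW.
Unshelve. all: by end_near. Qed.

(** This places the argument of the last M in [c_explicit] where M is positive. With L = J'(1/2^-),
    tangents at points close to 1/2, evaluated at 1/4, give J(1/2) - J(1/4) <= L / 4. *)
Lemma ratio_half_bounds : (f 0%R < +oo)%E -> (dJ_half mu f < +oo)%E ->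
  0 < ratio_half mu f <= 1 / 2.
Proof.
move=> f0 dy; have a01 : 0 < (1 / 4 : R) < 1 / 2 by apply/andP; split; lra.
have dge := dJ_half_ge a01; have d4 := dJ_pos a01.
have dfin : dJ_half mu f \is a fin_num.
  by rewrite ge0_fin_numE// (le_trans _ dge)// lee_fin ltW.
have dE := fineK dfin; set L := fine (dJ_half mu f) in dE.
have L4 : derive1 Jm (1 / 4) <= L by rewrite -lee_fin dE.
have L0 : 0 < L by exact: lt_le_trans d4 _.
have J4 : 0 <= Jm (1 / 4).
  rewrite /J fine_ge0// /Jext; case: ifP => // _; exact: classF_ge0 muF _.
have f0fin : f 0 \is a fin_num by rewrite ge0_fin_numE//; exact: classF_ge0 muF _.
have J2 : Jm (1 / 2) <= Jm (1 / 4) + L / 4.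
  rewrite -(distr0 (classF_noatom muF) (classF_sym muF)) J_distr// -lee_fin fineK//.
  apply: (cvge_to_le (cvg_dnbhs_at_left (classF_at0 muF))); near=> x.
  have x0 : x < 0 by near: x; exact: nbhs_left_lt.
  rewrite -(fineK_density muF); last by rewrite lt_eqF.
  rewrite -(J_distr muF) lee_fin.
  have t01 : 0 < F x < 1 / 2 by rewrite (distr_gt0 muF) (distr_lt_half muF).
  have := tangent_le t01 a01; have := dJ_half_ge t01.
  rewrite -dE lee_fin => tL.
  have [t4|t4] := leP (F x) (1 / 4).
    have /andP[t0 t2] := t01.
    have : 0 <= derive1 Jm (F x) * (1 / 4 - F x).
      by rewrite mulr_ge0 ?subr_ge0// ltW// dJ_pos.
    lra.
  have /andP[t0 t2] := t01.
  have : derive1 Jm (F x) * (F x - 1 / 4) <= L * (1 / 4).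
    by apply: ler_pM => //; [exact/ltW/dJ_pos|lra|lra].
  lra.
rewrite /ratio_half -dE inver gt_eqF//=; have := J_half_gt f0 => N0.
by rewrite divr_gt0//= ler_pdivrMr//; lra.
Unshelve. all: by end_near. Qed.

(** The entries 8 J'(p/2) and M(p), divided by 32, give the two bounds that [bound_i_min] asks
    for. *)
Lemma c_explicit_le p : c_explicit mu f p <= derive1 Jm (p / 2) / 4 /\
  c_explicit mu f p <= Minf mu f p / 32.
Proof.
rewrite /c_explicit; set x := 8 * _; set y := Num.min (16 * _) _.
have h1 : Num.min x (Num.min (Minf mu f p) y) <= x by rewrite ge_min lexx.
have h2 : Num.min x (Num.min (Minf mu f p) y) <= Minf mu f p.
  by rewrite !ge_min lexx orbT.
rewrite /x in h1 h2 *; split; lra.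
Qed.

Lemma c_explicit_gt0 p : (f 0%R < +oo)%E -> 0 < p <= 1 / 2 ->
  (dJ_half mu f < +oo)%E \/ 0 < Minf mu f 0 -> 0 < c_explicit mu f p.
Proof.
move=> f0 p01 dM; have /andP[p0 p2] := p01; rewrite /c_explicit.
have Mr : 0 < Minf mu f (ratio_half mu f).
  have [dy|dy] := ltP (dJ_half mu f) +oo%E.
    exact/M_gt0/ratio_half_bounds.
  (* If J'(1/2^-) is infinite, the ratio is 0 and the last entry becomes 4 M(0). *)
  case: dM => [|M0]; first by rewrite ltNge dy.
  have {}dy : dJ_half mu f = +oo%E by apply/eqP; rewrite -leye_eq.
  by rewrite /ratio_half dy invey mule0.
have d6 : 0 < derive1 Jm (1 / 6) by apply: dJ_pos; apply/andP; split; lra.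
have dp : 0 < derive1 Jm (p / 2) by apply: dJ_pos; apply/andP; split; lra.
have Mp := M_gt0 p01; have J4 := J_half_gt f0.
by rewrite mulr_gt0 ?divr_gt0// !lt_min Mp !mulr_gt0.
Qed.

(** * Constants when J' is concave *)

Section SecondPart.
Variable eps : R.
Hypothesis hyp : hyp_ii mu f eps.

Lemma J2_nonincreasing s t : 0 < s -> s <= t -> t < 1 / 2 ->
  derive1n 2 Jm t <= derive1n 2 Jm s.
Proof.
move=> s0; rewrite le_eqVlt => /predU1P[->//|st] t2; have [_ _ cJ _] := hyp.
apply: (concave_derive1_nonincreasing cJ _ s0 st t2) => u u01.
by have [_ ? _] := JC2 u01.
Qed.

(** Concavity of J' makes J'' nonincreasing, and M(1/2) > 0 bounds it below near 1/2. The limit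
    therefore exists, is positive, and lies below J'' on the whole interval. *)
Lemma d2J_half_bounds :
  0 < d2J_half mu f /\ {in `]0, 1 / 2[, forall t, d2J_half mu f <= derive1n 2 Jm t}.
Proof.
have p01 : 0 < (1 / 2 : R) <= 1 / 2 by apply/andP; split; lra.
have Mle t : 1 / 4 <= t -> t < 1 / 2 -> Minf mu f (1 / 2) <= derive1n 2 Jm t.
  by move=> h1 h2; apply: Minf_le => //; apply/andP; split; lra.
have cv : cvg (derive1n 2 Jm s @[s --> (1 / 2 : R)^'-]).
  have : cvg (derive1n 2 Jm (- s) @[s --> (- (1 / 2) : R)^'+]).
    apply: nondecreasing_at_right_is_cvgr; near=> x.
      move=> r s; rewrite !in_itv/= => /andP[hr rx] /andP[hs sx] rs.
      have x0 : x < 0 by near: x; apply: nbhs_right_lt; lra.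
      apply: J2_nonincreasing; lra.
    exists (Minf mu f (1 / 2)) => _ [s + <-]; rewrite /= in_itv/= => /andP[h1 h2].
    have x0 : x < - (1 / 4) by near: x; apply: nbhs_right_lt; lra.
    apply: Mle; lra.
  move=> /cvg_ex[l hl]; apply/cvg_ex; exists l.
  exact/(cvg_at_leftNP (derive1n 2 Jm)).
split.
  apply: lt_le_trans (M_gt0 p01) _; apply: limr_ge => //; near=> s.
  have s4 : 1 / 4 < s by near: s; apply: nbhs_left_gt; lra.
  have s2 : s < 1 / 2 by near: s; exact: nbhs_left_lt.
  exact/Mle/s2/ltW.
move=> t; rewrite in_itv/= => /andP[t0 t2]; apply: limr_le => //; near=> s.
have ts : t < s by near: s; exact: nbhs_left_gt.
have s2 : s < 1 / 2 by near: s; exact: nbhs_left_lt.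
by apply: J2_nonincreasing => //; exact: ltW.
Unshelve. all: by end_near. Qed.

Lemma dJ_ge_d2J_half a : 0 < a < 1 / 2 -> d2J_half mu f * a <= derive1 Jm a.
Proof.
move=> /andP[a0 a2]; have [D0 Dle] := d2J_half_bounds.
have hD : {in `]0, 1 / 2[, forall t, is_derive t 1 (derive1 Jm) (derive1n 2 Jm t)}.
  move=> t /JC2[_ dd _]; rewrite [derive1n 2 Jm t]derive1E; exact/derivableP.
rewrite -[leRHS]addr0 -[leRHS]addr0; apply/ler_addgt0Pr => e e0; rewrite !addr0.
(* On [t, a] the derivative J' grows by at least D (a - t), where D = J''(1/2^-); J'(t) > 0, and
   this t makes the loss D t at most e. *)
pose t := Num.min (a / 2) (e / d2J_half mu f).
have t0 : 0 < t by rewrite lt_min !divr_gt0.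
have ta : t <= a / 2 by rewrite ge_min lexx.
have te : d2J_half mu f * t <= e.
  by rewrite mulrC -ler_pdivlMr// ge_min lexx orbT.
have ta' : t < a by lra.
have sub u : u \in `[t, a] -> u \in `]0, 1 / 2[.
  by rewrite !in_itv/= => /andP[? ?]; apply/andP; split; lra.
have dw : {within `[t, a], continuous (derive1 Jm)}.
  by apply: derivable_within_continuous => u /sub/hD[].
have [c cta E] := @MVT _ (derive1 Jm) (derive1n 2 Jm) t a ta'
  (fun u h => hD u (sub u (subset_itv_oo_cc h))) dw.
have : d2J_half mu f * (a - t) <= derive1n 2 Jm c * (a - t).
  by rewrite ler_pM2r ?subr_gt0// Dle// sub// subset_itv_oo_cc.
have dt : 0 < derive1 Jm t by apply: dJ_pos; apply/andP; split; lra.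
rewrite -E; lra.
Qed.

Lemma c'_explicit_gt0 : 0 < c'_explicit mu f eps.
Proof.
have [_ [e0 _] _ _] := hyp; have [D0 _] := d2J_half_bounds.
by rewrite /c'_explicit divr_gt0// mulr_gt0.
Qed.

(** With m = D = J''(1/2^-), the value D / 8 meets both requirements of [bound_ii_of_le], because
    J'(p/2) >= D p / 2; and eps < 1 places c' below D / 8, whatever p is. *)
Lemma bound_ii_explicit p lam : 0 <= p <= 1 / 2 -> 0 <= lam <= 2 * p ->
  bound_ii mu f p lam (c'_explicit mu f eps).
Proof.
move=> /andP[]; rewrite le_eqVlt => /predU1P[<- _ lp|p0 p2 lp].
  move=> E mE _ muE lamE; have := bound_i0 0 lp mE muE lamE.
  by move: lp; rewrite mulr0 -eq_le => /eqP<-; rewrite expr0n/= !mulr0.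
have [e1 [e0 _] _ _] := hyp; have [D0 Dle] := d2J_half_bounds.
have cD : c'_explicit mu f eps <= d2J_half mu f / 8.
  have : eps * d2J_half mu f <= d2J_half mu f by rewrite ler_piMl// ltW.
  by rewrite /c'_explicit; lra.
apply: (bound_ii_of_le muF JC2 J2_ge0 p0 p2 (ltW D0) _ lp) => //.
  move=> t; rewrite in_itv/= => /andP[h1 h2]; apply: Dle.
  by rewrite in_itv/=; apply/andP; split; lra.
apply: le_trans cD _; rewrite ler_pdivlMr ?mulr_gt0//.
have := @dJ_ge_d2J_half (p / 2); rewrite divr_gt0//= => h.
have := h (ltac:(lra)); lra.
Qed.

End SecondPart.

End Constants.

Theorem theorem4p7 (R : realType) (mu : probability (measurableTypeR R) R)
    (f : R -> \bar R)
    (muF : classF mu f)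
    (JC2 : C2_on `]0, 1 / 2[%classic (J mu f))
    (M_gt0 : forall p : R, 0 < p <= 1 / 2 -> 0 < Minf mu f p) :
  [/\ (* (i) *)
      forall p : R, 0 <= p <= 1 / 2 ->
        exists2 c : R, 0 < c &
          forall lam : R, 0 <= lam <= 2 * p -> bound_i mu f p lam c,
      (* (ii) *)
      forall eps : R, hyp_ii mu f eps ->
        exists2 c' : R, 0 < c' &
          forall p lam : R, 0 <= p <= 1 / 2 -> 0 <= lam <= 2 * p ->
            bound_ii mu f p lam c',
      (* admissible c; the formula involves J(1/2) = f 0, and its sign is only
         asserted where each of its terms is defined *)
      (f 0%R < +oo)%E ->
        forall p : R, 0 <= p <= 1 / 2 ->
          (0 < p -> (dJ_half mu f < +oo)%E \/ 0 < Minf mu f 0 ->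
             0 < c_explicit mu f p) /\
          forall lam : R, 0 <= lam <= 2 * p ->
            bound_i mu f p lam (c_explicit mu f p)
    & (* admissible c' *)
      forall eps : R, hyp_ii mu f eps ->
        0 < c'_explicit mu f eps /\
        forall p lam : R, 0 <= p <= 1 / 2 -> 0 <= lam <= 2 * p ->
          bound_ii mu f p lam (c'_explicit mu f eps)].
Proof.
split=> [p p01|eps hyp|f0 p p01|eps hyp].
- have /andP[] := p01; rewrite le_eqVlt => /predU1P[<- _|p0 p2].
    by exists 1 => // lam; exact: bound_i0.
  (* Here f(0) may be infinite, and [c_explicit] contains J(1/2); these are the two upper bounds
     that [bound_i_min] puts on c. *)
  exists (Num.min (derive1 (J mu f) (p / 2) / 4) (Minf mu f p / 32)).
    rewrite lt_min !divr_gt0 ?M_gt0 ?p0//.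
    by apply: (dJ_pos muF JC2 M_gt0); apply/andP; split; lra.
  move=> lam lp; apply: bound_i_min => //; by rewrite ge_min lexx ?orbT.
- exists (c'_explicit mu f eps); first exact: c'_explicit_gt0 hyp.
  by move=> p lam p01 lp; exact: (bound_ii_explicit muF JC2 M_gt0 hyp).
- split=> [p0 dM|lam lp].
    by apply: c_explicit_gt0 => //; rewrite p0; have /andP[] := p01.
  by have [h1 h2] := c_explicit_le mu f p; exact: bound_i_min.
- split; first exact: c'_explicit_gt0 hyp.
  by move=> p lam p01 lp; exact: (bound_ii_explicit muF JC2 M_gt0 hyp).
Qed.
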